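(* There is a universal constant $C>0$ such that for all $d\ge1$ and all $T\geq 110d^2$, the algorithm BISONS (defined in the context) run with parameters $B=\frac{264}{5}d\log(T)$, $\eta=\frac{1}{4B}$, $\beta=\frac{11}{7B}$ satisfies, for every sequence of returns vectors $r_1,\dots,r_T\in\Delta([d])$, $$\max_{u\in\Delta([d])}\sum_{t=1}^T\big(f_t(x_t)-f_t(u)\big)\leq C\,d^2\log^2(T).$$
   Context: Online portfolio problem: $\Delta([d])$ is the probability simplex in $\mathbb{R}^d$. In each round $t=1,\dots,T$ the learner plays $x_t\in\Delta([d])$, then observes a returns vector $r_t\in\Delta([d])$ (arbitrary, possibly adversarial) and suffers the loss $f_t(x_t)$ where $f_t(x)=-\log(\langle x,r_t\rangle)$. Let $R(x)=-\sum_{i=1}^d\log(x_i)$. BISONS with inputs $T,B,\eta,\beta$ operates in epochs. The first epoch starts at round $1$. Within an epoch there is an internal time $\tau=1,2,\dots$, and all quantities below are started afresh in each epoch (nothing is remembered from earlier epochs). Set $p_0=d\mathbf{1}$, $x_1=u_1=\arg\min_{x\in\Delta([d])}R(x)=\frac1d\mathbf 1$, and for all $\tau\ge1$, $i\in[d]$: $p_{\tau,i}=\max\{p_{\tau-1,i},x_{\tau,i}^{-1}\}$ (so $p_1=d\mathbf 1$). In the global round $t$ corresponding to internal time $\tau$ of the current epoch the algorithm plays $x_t=x_\tau$, receives $f_\tau:=f_t$, and forms $$\hat f_\tau(x)=f_\tau(x_\tau)+\langle x-x_\tau,\nabla f_\tau(x_\tau)\rangle+\tfrac{\beta}{2}\langle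 x-x_\tau,\nabla f_\tau(x_\tau)\rangle^2,\qquad g_\tau(x)=\hat f_\tau(x)-B\langle x,p_\tau-p_{\tau-1}\rangle .$$ It then computes $$x_{\tau+1}=\arg\min_{x\in\Delta([d])}\sum_{s=1}^{\tau}g_s(x)+\eta^{-1}R(x),\qquad u_{\tau+1}=\arg\min_{x\in\Delta([d])}\sum_{s=1}^{\tau}\hat f_s(x)+\eta^{-1}R(x),$$ and $p_{\tau+1}$. If there is $i\in[d]$ with $2(1+6\eta)\beta\,u_{\tau+1,i}\geq (p_{\tau+1,i})^{-1}$ (the reset condition), the epoch ends with round $t$ and a new epoch starts in round $t+1$; otherwise $\tau$ is increased by one and the epoch continues. *)

(* Defs.v *)
From HB Require Import structures.
From mathcomp Require Import all_boot all_order all_algebra.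
From mathcomp Require Import all_classical all_reals all_analysis.

Set Implicit Arguments.
Unset Strict Implicit.
Unset Printing Implicit Defensive.

Import Order.TTheory GRing.Theory Num.Theory.
Import numFieldNormedType.Exports.

Local Open Scope classical_set_scope.
Local Open Scope ring_scope.

Section OnlinePortfolio.
Context {R : realType} {d : nat}.
Implicit Types (x y r p : 'rV[R]_d).

Definition simplex : set 'rV[R]_d :=
  [set x | (forall i, 0 <= x 0 i) /\ \sum_i x 0 i = 1].

Definition dot x y : R := \sum_i x 0 i * y 0 i.

(* The loss of x is +oo when <x, r> = 0 (as lne 0 = -oo), which can happen
   for comparators on the boundary of the simplex. *)
Definition loss r x : \bar R := (- lne (dot x r)%:E)%E.

Definition barrier x : \bar R := (- \sum_i lne (x 0 i)%:E)%E.

Definition gradient (F : 'rV[R]_d -> R) x : 'rV[R]_d :=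
  \row_i 'D_(delta_mx 0 i) F x.

(* Arbitrary (namely 0) if F has no minimizer on the simplex. *)
Definition argmin (F : 'rV[R]_d -> \bar R) : 'rV[R]_d :=
  xget 0 [set x | simplex x /\ forall y, simplex y -> (F x <= F y)%E].

(* hat f_tau, for the returns vector r and the iterate z = x_tau. The loss is
   finite around z whenever dot z r > 0, hence the use of fine. *)
Definition surrogate (beta : R) r (z : 'rV[R]_d) : 'rV[R]_d -> R :=
  let f := fun y => fine (loss r y) in
  let grad := gradient f z in
  fun x => f z + dot (x - z) grad + beta / 2 * dot (x - z) grad ^+ 2.

Definition update_p p x : 'rV[R]_d :=
  \row_i Num.max (p 0 i) (x 0 i)^-1.

Definition regularized_leader (eta : R) (gs : seq ('rV[R]_d -> R)) :=
  argmin (fun x => (\sum_(g <- gs) g x)%:E + (eta^-1)%:E * barrier x)%E.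

(* Situation at the beginning of the round of internal time tau. *)
Record bisons_state := BisonsState {
  fhats : seq ('rV[R]_d -> R);  (* hat f_s for s < tau, latest first *)
  gs : seq ('rV[R]_d -> R);     (* g_s for s < tau, latest first *)
  p_prev : 'rV[R]_d;            (* p_(tau - 1) *)
  play : 'rV[R]_d               (* x_tau *)
}.

Definition bisons_init : bisons_state :=
  BisonsState [::] [::] (const_mx d%:R) (argmin barrier).

Definition bisons_step (B eta beta : R) (s : bisons_state) r : bisons_state :=
  let p := update_p (p_prev s) (play s) in
  let fhat := surrogate beta r (play s) in
  let g := fun x => fhat x - B * dot x (p - p_prev s) in
  let x' := regularized_leader eta (g :: gs s) in
  let u' := regularized_leader eta (fhat :: fhats s) in
  let p' := update_p p x' in
  if [exists i, 2 * (1 + 6 * eta) * beta * u' 0 i >= (p' 0 i)^-1]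
  then bisons_init
  else BisonsState (fhat :: fhats s) (g :: gs s) p x'.

(* Rounds are numbered from 0: r t is the returns vector of round t, and the
   state at the beginning of round t depends only on r 0, ..., r (t - 1). *)
Fixpoint bisons_run (B eta beta : R) (r : nat -> 'rV[R]_d) (t : nat)
    : bisons_state :=
  if t is t'.+1 then bisons_step B eta beta (bisons_run B eta beta r t') (r t')
  else bisons_init.

Definition bisons (B eta beta : R) (r : nat -> 'rV[R]_d) (t : nat) : 'rV[R]_d :=
  play (bisons_run B eta beta r t).

Definition regret (T : nat) (r x : nat -> 'rV[R]_d) : \bar R :=
  ereal_sup [set (\sum_(t < T) (loss (r t) (x t) - loss (r t) u))%E
            | u in simplex].

End OnlinePortfolio.

(* Main.v *)
Require Import Defs.
From HB Require Import structures.
From mathcomp Require Import all_boot all_order all_algebra.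
From mathcomp Require Import all_classical all_reals all_analysis.
From mathcomp Require Import perm ring lra.

(** With [rho_s = r_s / <x_s, r_s>] the surrogate of round [s] is
    [f_s(x_s) + (1 - <y, rho_s>) + beta / 2 (1 - <y, rho_s>)^2], so everything
    inside an epoch depends on the [rho_s] and on [p] only, and
    [f_s(x_s) - f_s(u) = ln <u, rho_s>].

    Comparison with [u]: at a point [u'] with [beta (1 + <u', rho_s>) <= 1] the
    tangent of the surrogate lies below [f_s] everywhere. If [u'] is the leader
    for the surrogates, its optimality condition thus bounds
    [sum f_s(u) + R(u) / eta] below by the optimal surrogate value, for every
    [u]. The hypothesis on [u'] holds as long as no reset occurs, since
    [<u', rho_s> <= max_i u'_i p_i], and survives one more round because [u'] is
    multiplicatively stable.

    Regret of the plays: the relative change of the play in a round has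
    Euclidean norm at most [2 eta], so the barrier is at least quadratic along a
    step, and the cost of a round is bounded by the increments of
    [ln det (a I + sum rho_s rho_s^T)] (elliptical potential) and of
    [sum_i ln p_i] (bias). Both potentials are [O(d ln T)] since
    [p_i <= 7 B / (22 u_i)] and the leader [u_i] is at least [10 / T].

    Altogether an epoch costs at most [9 B d ln T - B <u', p>]. A reset means
    [u'_i p_i >= 11 d ln T] for some [i], so completed epochs have
    nonpositive regret and only the last one counts. *)

Set Implicit Arguments.
Unset Strict Implicit.
Unset Printing Implicit Defensive.

Import Order.TTheory GRing.Theory Num.Theory.
Import numFieldNormedType.Exports.

Local Open Scope ring_scope.

(** * Continuity of real-valued functions *)

Section RealValuedContinuity.
Context {R : realType} {T : topologicalType}.
Implicit Types (f g : T -> R) (x : T).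

Lemma continuous_add f g x : continuous_at x f -> continuous_at x g ->
  continuous_at x (fun y => f y + g y).
Proof. by move=> cf cg; apply: cvgD. Qed.

Lemma continuous_opp f x :
  continuous_at x f -> continuous_at x (fun y => - f y).
Proof. by move=> cf; apply: cvgN. Qed.

Lemma continuous_mul f g x : continuous_at x f -> continuous_at x g ->
  continuous_at x (fun y => f y * g y).
Proof. by move=> cf cg; apply: cvgM. Qed.

Lemma continuous_sum (I : Type) (s : seq I) (F : I -> T -> R) x :
  (forall i, continuous_at x (F i)) ->
  continuous_at x (fun y => \sum_(i <- s) F i y).
Proof.
by move=> cF; apply: cvg_big => [|i _]; [exact: add_continuous|exact: cF].
Qed.

End RealValuedContinuity.

(** * The inner product on row vectors *)

Section Dot.
Context {R : realType} {d : nat}.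
Implicit Types x y z : 'rV[R]_d.

Lemma dotDl x y z : dot (x + y) z = dot x z + dot y z.
Proof.
rewrite /dot -big_split /=; apply: eq_bigr => i _.
by rewrite mxE mulrDl.
Qed.

Lemma dotZl (c : R) x y : dot (c *: x) y = c * dot x y.
Proof.
by rewrite /dot mulr_sumr; apply: eq_bigr => i _; rewrite mxE mulrA.
Qed.

Lemma dotC x y : dot x y = dot y x.
Proof. by apply: eq_bigr => i _; rewrite mulrC. Qed.

Lemma dotDr x y z : dot z (x + y) = dot z x + dot z y.
Proof. by rewrite !(dotC z) dotDl. Qed.

Lemma dotZr (c : R) x y : dot x (c *: y) = c * dot x y.
Proof. by rewrite !(dotC x) dotZl. Qed.

Lemma dotNl x y : dot (- x) y = - dot x y.
Proof. by rewrite -scaleN1r dotZl mulN1r. Qed.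

Lemma dotNr x y : dot x (- y) = - dot x y.
Proof. by rewrite !(dotC x) dotNl. Qed.

Lemma dotBl x y z : dot (x - y) z = dot x z - dot y z.
Proof. by rewrite dotDl dotNl. Qed.

Lemma dotBr x y z : dot z (x - y) = dot z x - dot z y.
Proof. by rewrite dotDr dotNr. Qed.

Lemma dot_delta i x : dot (delta_mx 0 i) x = x 0 i.
Proof.
rewrite /dot (bigD1 i)//= mxE !eqxx mul1r big1 ?addr0// => j ji.
by rewrite mxE (negbTE ji) andbF mul0r.
Qed.

Lemma dot0r x : dot x 0 = 0.
Proof. by rewrite -(scale0r (0 : 'rV[R]_d)) dotZr mul0r. Qed.

Lemma dot_continuous y : continuous (fun x => dot x y).
Proof.
move=> x; apply: continuous_sum => i.
by apply: continuous_mul; [exact: coord_continuous|exact: cst_continuous].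
Qed.

End Dot.

(** * Quadratic objectives and their optimality condition *)

Section Leader.
Context {R : realType} {d : nat}.
Implicit Types (x y u b rho : 'rV[R]_d) (h : seq 'rV[R]_d).

(* With [rho = r / <z, r>], the surrogate loss at [z] is
   [f z + (1 - <y, rho>) + beta / 2 (1 - <y, rho>)^2]. *)
Definition quad (beta : R) h b y : R :=
  \sum_(rho <- h) ((1 - dot y rho) + beta / 2 * (1 - dot y rho) ^+ 2)
  - dot y b.

(** Directional derivative of [quad beta h b] at [y] along [e]. *)
Definition dquad (beta : R) h b y e : R :=
  - (\sum_(rho <- h) (1 + beta * (1 - dot y rho)) * dot e rho) - dot e b.

Definition sqdots h e : R := \sum_(rho <- h) dot e rho ^+ 2.

(** As [ln] is 0 on nonpositive reals, this stands for [barrier] only at points with positive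
    coordinates. *)
Definition logbar x : R := - \sum_i ln (x 0 i).

Lemma quadD beta h b y e :
  quad beta h b (y + e) =
  quad beta h b y + dquad beta h b y e + beta / 2 * sqdots h e.
Proof.
rewrite /quad /dquad /sqdots dotDl mulr_sumr.
suff -> : \sum_(rho <- h) (1 - dot (y + e) rho
      + beta / 2 * (1 - dot (y + e) rho) ^+ 2) =
    \sum_(rho <- h) (1 - dot y rho + beta / 2 * (1 - dot y rho) ^+ 2)
    - \sum_(rho <- h) (1 + beta * (1 - dot y rho)) * dot e rho
    + \sum_(rho <- h) (beta / 2 * dot e rho ^+ 2) by ring.
rewrite -sumrN -!big_split /=; apply: eq_bigr => rho _.
by rewrite dotDl; field.
Qed.

Lemma quad_nil beta y : quad beta [::] 0 y = 0.
Proof. by rewrite /quad big_nil dot0r subr0. Qed.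

Lemma dquadZ beta h b y (c : R) e :
  dquad beta h b y (c *: e) = c * dquad beta h b y e.
Proof.
rewrite /dquad dotZl mulrBr mulrN; congr (- _ - _); rewrite mulr_sumr.
by apply: eq_bigr => rho _; rewrite dotZl; ring.
Qed.

Lemma sqdotsZ h (c : R) e : sqdots h (c *: e) = c ^+ 2 * sqdots h e.
Proof.
by rewrite /sqdots mulr_sumr; apply: eq_bigr => rho _; rewrite dotZl exprMn.
Qed.

Lemma sqdots_ge0 h e : 0 <= sqdots h e.
Proof. by apply: sumr_ge0 => rho _; exact: sqr_ge0. Qed.

Lemma quad_continuous beta h b : continuous (quad beta h b).
Proof.
move=> x; change (continuous_at x (quad beta h b)).
apply: continuous_add; last by apply: continuous_opp; exact: dot_continuous.
apply: continuous_sum => rho.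
have cd : continuous_at x (fun y => 1 - dot y rho).
  apply: continuous_add; first exact: cst_continuous.
  by apply: continuous_opp; exact: dot_continuous.
apply: continuous_add => //; apply: continuous_mul.
  exact: cst_continuous.
rewrite (_ : (fun y => _) = fun y => (1 - dot y rho) * (1 - dot y rho)).
  exact: continuous_mul.
by apply/funext => y; rewrite expr2.
Qed.

(* The last field is the first-order optimality condition. *)
Definition leader (beta eta : R) h b x : Prop :=
  [/\ simplex x, forall i, 0 < x 0 i &
      forall y, simplex y ->
        0 <= dquad beta h b x (y - x)
             - eta^-1 * \sum_i (y 0 i - x 0 i) / x 0 i].

End Leader.

(** * Elementary bounds on the logarithm *)

Section LogBounds.
Context {R : realType}.
Implicit Types x y t : R.

Lemma ln_le_sub1 x : 0 < x -> ln x <= x - 1.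
Proof.
move=> x0; have -> : ln x = ln (1 + (x - 1)) by congr ln; ring.
by apply: le_ln1Dx; lra.
Qed.

Lemma ln_ge_sub1V x : 0 < x -> 1 - x^-1 <= ln x.
Proof.
move=> x0; have := @ln_le_sub1 x^-1; rewrite invr_gt0 x0 lnV ?posrE//.
move=> /(_ isT).
lra.
Qed.

Lemma ln1D_ge t : - 2^-1 <= t -> t - 2 * t ^+ 2 <= ln (1 + t).
Proof.
move=> t2; apply: le_trans (@ln_ge_sub1V (1 + t) _); last by lra.
have t1 : 0 < 1 + t by lra.
have -> : 1 - (1 + t)^-1 = t / (1 + t) by field; apply/eqP; lra.
by rewrite ler_pdivlMr//; have := sqr_ge0 t; nra.
Qed.

(** Split [1 + t] into [s], [s] and [(1 + t) / s ^+ 2] with [s = 1 + t / 2], and use [ln z <= z - 1]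
    on each factor. The last one is [1 - t ^+ 2 / (4 * s ^+ 2)], and [s ^+ 2 <= 3 / 2] because
    [t <= 1 / 4]. *)
Lemma ln1D_le t : -1 < t -> t <= 1 / 4 -> ln (1 + t) <= t - t ^+ 2 / 6.
Proof.
move=> tN1 t14; pose s := 1 + t / 2.
have s0 : 0 < s by rewrite /s; lra.
have t1 : 0 < 1 + t by lra.
have lnE : ln (1 + t) = ln s + ln s + ln ((1 + t) / s ^+ 2).
  rewrite -!lnM ?posrE ?divr_gt0 ?mulr_gt0 ?exprn_gt0//.
  by congr ln; field; apply/eqP; lra.
have ls : ln s <= t / 2 by have := ln_le_sub1 s0; rewrite /s; lra.
have lr : ln ((1 + t) / s ^+ 2) <= - (t ^+ 2 / 6).
  apply: le_trans (ln_le_sub1 _) _; first by rewrite divr_gt0 ?exprn_gt0.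
  have -> : (1 + t) / s ^+ 2 - 1 = - (t ^+ 2 / (4 * s ^+ 2)).
    rewrite /s; field; apply/eqP; move: s0; rewrite /s; lra.
  rewrite lerN2 ler_pM ?sqr_ge0 ?invr_ge0//.
  rewrite lef_pV2 ?posrE ?mulr_gt0 ?exprn_gt0// /s.
  nra.
lra.
Qed.

End LogBounds.

(** * Existence of regularized minimizers *)

Section LeaderExistence.
Context {R : realType} {d : nat}.
Implicit Types (x y u b rho : 'rV[R]_d) (h : seq 'rV[R]_d).

Definition simplex_above (e : R) : set 'rV[R]_d :=
  [set x | simplex x /\ forall i, e <= x 0 i]%classic.

Lemma simplex_le1 x i : simplex x -> x 0 i <= 1.
Proof.
by move=> [x0 <-]; rewrite (bigD1 i)//= lerDl; apply: sumr_ge0.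
Qed.

Lemma simplex_center : (0 < d)%N -> simplex (const_mx d%:R^-1 : 'rV[R]_d).
Proof.
move=> d0; split=> [i|]; first by rewrite mxE invr_ge0.
under eq_bigr do rewrite mxE.
by rewrite sumr_const card_ord -[LHS]mulr_natr mulVf// pnatr_eq0 -lt0n.
Qed.

Lemma compact_simplex_above e : 0 <= e -> compact (simplex_above e).
Proof.
move=> e0; have -> : simplex_above e =
    ([set x : 'rV[R]_d | forall i, `[e, 1]%classic (x 0 i)] `&`
     (fun x : 'rV[R]_d => \sum_i x 0 i) @^-1` [set 1%R])%classic.
  apply/seteqP; split=> [x [sx xe]|x [xe x1]] /=.
    by split; [move=> i; rewrite in_itv /= xe simplex_le1|exact: sx.2].
  have ex i : e <= x 0 i by have := xe i; rewrite /= in_itv => /andP[].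
  by split=> //; split=> // i; exact: le_trans (ex i).
apply: compact_closedI.
  exact: (rV_compact (fun=> @segment_compact R e 1)).
apply: closed_comp; last exact: closed_eq.
by move=> x _; apply: continuous_sum => i; exact: coord_continuous.
Qed.

Lemma continuous_logbar_at x : (forall i, 0 < x 0 i) ->
  continuous_at x (@logbar R d).
Proof.
move=> x0; apply: continuous_opp; apply: continuous_sum => i.
apply: continuous_comp; first exact: coord_continuous.
exact: continuous_ln.
Qed.

Lemma ln_simplex_le0 x i : simplex x -> 0 < x 0 i -> ln (x 0 i) <= 0.
Proof. by move=> sx xi; apply: ln_le0; exact: simplex_le1. Qed.

Lemma logbar_ge_coord x i : simplex x -> (forall i, 0 < x 0 i) ->
  - ln (x 0 i) <= logbar x.
Proof.
move=> sx x0; rewrite lerN2 (bigD1 i)//= gerDl.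
by apply: sumr_le0 => j _; exact: ln_simplex_le0.
Qed.

(** The barrier blows up at the boundary, so for small [e] a minimizer on the compact set
    [simplex_above e] also beats every positive point outside it. *)
Lemma exists_regularized_min (q : 'rV[R]_d -> R) (a : R) :
  continuous q -> 0 < a -> (0 < d)%N ->
  exists x, [/\ simplex x, forall i, 0 < x 0 i &
    forall y, simplex y -> (forall i, 0 < y 0 i) ->
      q x + a * logbar x <= q y + a * logbar y].
Proof.
move=> cq a0 d0; pose c : 'rV[R]_d := const_mx d%:R^-1.
have dR : (0 : R) < d%:R by rewrite ltr0n.
have sc : simplex c by exact: simplex_center.
have [m mP] : exists m, forall y, simplex y -> m <= q y.
  have [//|x _ xP] := @compact_EVT_min _ _ q _ (ex_intro _ c _)
    (@compact_simplex_above 0 (lexx 0)) (continuous_subspaceT cq).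
    by split=> // i; exact: sc.1.
  by exists (q x) => y sy; apply: xP; rewrite inE; split=> // i; exact: sy.1.
pose v := q c + a * logbar c.
(* The first bound keeps the center in the truncation. If some [y 0 i] is below the second, its
   barrier term alone is at least [v - m], so [y] is no better than the center. *)
pose e := Num.min d%:R^-1 (expR (- ((v - m) / a))).
have e0 : 0 < e by rewrite lt_min invr_gt0 dR expR_gt0.
have ce : simplex_above e c by split=> // i; rewrite mxE ge_min lexx.
have cF : {within simplex_above e,
    continuous (fun y => q y + a * logbar y)}%classic.
  apply: continuous_in_subspaceT => y; rewrite inE => -[_ ye].
  apply: continuous_add; first exact: cq.
  apply: continuous_mul; first exact: cst_continuous.
  by apply: continuous_logbar_at => i; exact: lt_le_trans (ye i).
have [x] :=
  compact_EVT_min (ex_intro _ c ce) (compact_simplex_above (ltW e0)) cF.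
rewrite inE => -[sx xe] xP; exists x; split=> // [i|y sy y0].
  exact: lt_le_trans (xe i).
have [ye|/existsNP[i /negP]] := pselect (forall i, e <= y 0 i).
  by apply: xP; rewrite inE.
rewrite -ltNge => yie.
apply: le_trans (xP c _) _; first by rewrite inE.
rewrite -/v.
have lny : ln (y 0 i) <= - ((v - m) / a).
  rewrite -[leRHS]expRK ler_ln ?posrE ?expR_gt0//.
  by apply: le_trans (ltW yie) _; rewrite ge_min lexx orbT.
have := logbar_ge_coord i sy y0; have := mP y sy.
have : (v - m) / a * a = v - m by rewrite mulfVK// gt_eqF.
nra.
Qed.

(** Moving from [x] towards [y] by a fraction [s <= 1 / 2] changes the objective by at most
    [s * D + s ^+ 2 * C], where [C] collects the second-order terms; a negative slope [D] would
    contradict minimality for small [s]. *)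
Lemma regularized_min_leader beta eta h b x : 0 <= beta -> 0 < eta ->
  simplex x -> (forall i, 0 < x 0 i) ->
  (forall y, simplex y -> (forall i, 0 < y 0 i) ->
     quad beta h b x + eta^-1 * logbar x <= quad beta h b y + eta^-1 * logbar y)
  -> leader beta eta h b x.
Proof.
move=> beta0 eta0 sx x0 xmin; split=> // y sy.
set D := (X in 0 <= X); rewrite leNgt; apply/negP => D0.
pose t i := (y 0 i - x 0 i) / x 0 i.
pose C := beta / 2 * sqdots h (y - x) + 2 * eta^-1 * \sum_i t i ^+ 2.
have C0 : 0 <= C.
  apply: addr_ge0; apply: mulr_ge0; rewrite ?sqdots_ge0//.
  - by rewrite divr_ge0.
  - by rewrite mulr_ge0 ?invr_ge0// ltW.
  by apply: sumr_ge0 => i _; exact: sqr_ge0.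
have key s : 0 < s -> s <= 2^-1 -> 0 <= D + s * C.
  move=> s0 s2.
  have tN1 i : -1 <= t i.
    by rewrite /t ler_pdivlMr// mulN1r lerBrDl subrr sy.1.
  have zE i : (x + s *: (y - x)) 0 i = x 0 i * (1 + s * t i).
    by rewrite !mxE /t; field; rewrite gt_eqF.
  have z0 i : 0 < (x + s *: (y - x)) 0 i.
    by rewrite zE mulr_gt0//; have := tN1 i; nra.
  have sz : simplex (x + s *: (y - x)).
    split=> [i|]; first exact: ltW.
    under eq_bigr do rewrite !mxE.
    by rewrite big_split /= -mulr_sumr sumrB sx.2 sy.2 subrr mulr0 addr0.
  have := xmin _ sz z0.
  rewrite quadD dquadZ sqdotsZ.
  have -> : logbar (x + s *: (y - x)) = logbar x - \sum_i ln (1 + s * t i).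
    rewrite /logbar -opprD -big_split /=; congr (- _); apply: eq_bigr => i _.
    by rewrite zE lnM ?posrE//; have := tN1 i; nra.
  have : \sum_i (s * t i - 2 * (s * t i) ^+ 2) <= \sum_i ln (1 + s * t i).
    apply: ler_sum => i _; apply: ln1D_ge.
    by have := tN1 i; nra.
  rewrite sumrB -mulr_sumr.
  have -> : \sum_i 2 * (s * t i) ^+ 2 = 2 * s ^+ 2 * \sum_i t i ^+ 2.
    by rewrite mulr_sumr; apply: eq_bigr => i _; ring.
  rewrite /C /D; change (\sum_i (y 0 i - x 0 i) / x 0 i) with (\sum_i t i).
  set S1 := \sum_i t i; set S2 := \sum_i _; set L := \sum_i _.
  set Q := sqdots _ _; set DQ := dquad _ _ _ _ _ => lb mn.
  have ie0 : 0 < eta^-1 by rewrite invr_gt0.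
  have : 0 <= s * (DQ - eta^-1 * S1
      + s * (beta / 2 * Q + 2 * eta^-1 * S2)) by nra.
  by rewrite pmulr_rge0.
pose s := Num.min 2^-1 (- D / (2 * (C + 1))).
have s0 : 0 < s by rewrite lt_min invr_gt0 ltr0n divr_gt0 ?oppr_gt0//; lra.
have sD : s * (2 * (C + 1)) <= - D.
  by rewrite -ler_pdivlMr ?ge_min ?lexx ?orbT//; lra.
have := key s s0; rewrite ge_min lexx /= => /(_ isT).
nra.
Qed.

End LeaderExistence.

(** * The minimizers computed by the algorithm are leaders *)

Section Argmin.
Context {R : realType} {d : nat}.
Implicit Types (x y u b rho : 'rV[R]_d) (h : seq 'rV[R]_d).

Lemma barrier_pos x : (forall i, 0 < x 0 i) -> barrier x = (logbar x)%:E.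
Proof.
move=> x0; rewrite /barrier /logbar EFinN -sumEFin; congr (- _)%E.
by apply: eq_bigr => i _; rewrite lne_EFin.
Qed.

Lemma barrier_boundary x :
  simplex x -> ~ (forall i, 0 < x 0 i) -> barrier x = +oo%E.
Proof.
move=> sx /existsNP[i /negP]; rewrite -leNgt => xi.
rewrite /barrier (bigD1 i)// le0_lneNy ?lee_fin// addNye//.
Qed.

(** Existence of a minimizer rules out the default value in [argmin], and infinite values off the
    positive points keep the minimizer inside. The constant [c] absorbs the constant terms of the
    surrogates; [k = eta] covers the bare barrier. *)
Lemma argmin_leader beta eta h b (F : 'rV[R]_d -> \bar R) (c k : R) :
  (0 < d)%N -> 0 <= beta -> 0 < eta -> 0 < k ->
  (forall y, simplex y -> (forall i, 0 < y 0 i) ->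
     F y = (c + k * (quad beta h b y + eta^-1 * logbar y))%:E) ->
  (forall y, simplex y -> ~ (forall i, 0 < y 0 i) -> F y = +oo%E) ->
  leader beta eta h b (argmin F).
Proof.
move=> d0 beta0 eta0 k0 Fpos Fbd.
have ie0 : 0 < eta^-1 by rewrite invr_gt0.
have [x [sx x0 xmin]] :=
  exists_regularized_min (@quad_continuous R d beta h b) ie0 d0.
have [|sz zmin] := @xgetPex _ 0
  [set x | simplex x /\ forall y, simplex y -> (F x <= F y)%E]%classic.
  exists x; split=> // y sy.
  have [y0|y0] := pselect (forall i, 0 < y 0 i).
    by rewrite !Fpos// lee_fin lerD2l ler_pM2l//; exact: xmin.
  by rewrite (Fbd y)// leey.
rewrite -/(argmin F) in sz zmin *.
have z0 i : 0 < argmin F 0 i.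
  move: i; apply: contrapT => /(Fbd _ sz) Fz.
  by have := zmin x sx; rewrite Fz Fpos.
apply: regularized_min_leader => // y sy y0.
by have := zmin y sy; rewrite !Fpos// lee_fin lerD2l ler_pM2l.
Qed.

Lemma regularized_leaderP beta eta h b (gs : seq ('rV[R]_d -> R)) (c : R) :
  (0 < d)%N -> 0 <= beta -> 0 < eta ->
  (forall y, \sum_(g <- gs) g y = c + quad beta h b y) ->
  leader beta eta h b (regularized_leader eta gs).
Proof.
move=> d0 beta0 eta0 gsE; apply: (@argmin_leader _ _ _ _ _ c 1) => // y sy y0.
  by rewrite barrier_pos// gsE mul1r -EFinM -EFinD -addrA.
by rewrite barrier_boundary// gt0_muley ?lte_fin ?invr_gt0.
Qed.

Lemma argmin_barrier_leader beta eta :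
  (0 < d)%N -> 0 <= beta -> 0 < eta ->
  leader beta eta [::] 0 (argmin (@barrier R d)).
Proof.
move=> d0 beta0 eta0; apply: (@argmin_leader _ _ _ _ _ 0 eta) => // y sy y0.
  rewrite barrier_pos// quad_nil.
  by rewrite !add0r mulrA divff ?mul1r// gt_eqF.
exact: barrier_boundary.
Qed.

Lemma simplex_vertex i : simplex (delta_mx 0 i : 'rV[R]_d).
Proof.
split=> [j|]; first by rewrite mxE; case: (_ && _).
rewrite (bigD1 i)//= mxE !eqxx big1 ?addr0// => j ji.
by rewrite mxE (negbTE ji) andbF.
Qed.

(** The optimality condition tested at vertex [i]. *)
Lemma leader_vertex beta eta h b x i : leader beta eta h b x ->
  eta^-1 * ((x 0 i)^-1 - d%:R) <= dquad beta h b x (delta_mx 0 i - x).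
Proof.
move=> [sx x0 /(_ _ (simplex_vertex i))]; rewrite subr_ge0; congr (_ * _ <= _).
under eq_bigr do rewrite mulrBl divff ?gt_eqF//.
rewrite sumrB sumr_const card_ord (bigD1 i)//= mxE !eqxx big1 ?addr0 ?mul1r//.
by move=> j ji; rewrite mxE (negbTE ji) andbF mul0r.
Qed.

(** The vertex test gives at least [d%:R^-1] in every coordinate, and the coordinates sum to 1. *)
Lemma leader_nil beta eta x : 0 < eta ->
  leader beta eta [::] 0 x -> forall i, x 0 i = d%:R^-1.
Proof.
move=> eta0 lx; have [[_ x1] x0 _] := lx.
have xd i : d%:R^-1 <= x 0 i.
  have d0 : (0 : R) < d%:R by rewrite ltr0n; exact: leq_trans (ltn_ord i).
  have := leader_vertex i lx; rewrite /dquad big_nil dot0r.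
  rewrite oppr0 addr0 pmulr_rle0 ?invr_gt0// subr_le0 => xid.
  by rewrite -[leRHS]invrK lef_pV2 ?posrE ?invr_gt0.
have : \sum_i (x 0 i - d%:R^-1) = 0.
  rewrite sumrB x1 sumr_const card_ord -[_ *+ d]mulr_natr.
  have [d0|d0] := posnP d; last by rewrite mulVf ?subrr// pnatr_eq0 -lt0n.
  move: x1; rewrite big1 => [/esym/eqP|i]; first by rewrite oner_eq0.
  by have := ltn_ord i; rewrite {2}d0.
move=> /eqP; rewrite psumr_eq0 => [/allP xdE i|i _]; last by rewrite subr_ge0.
by have := xdE i (mem_index_enum _); rewrite subr_eq0 => /eqP.
Qed.

End Argmin.

(** * Growth, stability and comparison inequalities for leaders *)

Section LeaderInequalities.
Context {R : realType} {d : nat}.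
Implicit Types (x y u b rho : 'rV[R]_d) (h : seq 'rV[R]_d).

(** The second-order expansion of [quad] is exact, and [t i - ln (1 + t i)] sums to the Bregman
    divergence of the barrier; optimality disposes of the first-order part. *)
Lemma leader_strong_min beta eta h b x y (t : 'I_d -> R) :
  leader beta eta h b x -> simplex y -> (forall i, 0 < y 0 i) ->
  (forall i, t i = (y 0 i - x 0 i) / x 0 i) ->
  quad beta h b x + eta^-1 * logbar x + beta / 2 * sqdots h (y - x)
    + eta^-1 * \sum_i (t i - ln (1 + t i))
  <= quad beta h b y + eta^-1 * logbar y.
Proof.
move=> [sx x0 foc] sy y0 tE.
have {foc} := foc y sy.
have -> : logbar y = logbar x - \sum_i ln (1 + t i).
  rewrite /logbar -opprD -big_split /=; congr (- _); apply: eq_bigr => i _.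
  have yE : y 0 i = x 0 i * (1 + t i).
    by rewrite tE; field; rewrite gt_eqF.
  rewrite {1}yE lnM ?posrE//; have := y0 i; rewrite yE.
  by rewrite pmulr_rgt0.
have -> : quad beta h b y = quad beta h b x + dquad beta h b x (y - x)
    + beta / 2 * sqdots h (y - x).
  by rewrite -quadD addrC subrK.
under eq_bigr do rewrite -tE.
by rewrite sumrB; lra.
Qed.

Lemma dquadB beta h b x y e :
  dquad beta h b (x + e) y - dquad beta h b x y =
  beta * \sum_(rho <- h) dot e rho * dot y rho.
Proof.
rewrite /dquad mulr_sumr opprD !opprK addrACA addNr addr0 addrC -sumrB.
by apply: eq_bigr => rho _; rewrite dotDl; ring.
Qed.

(** Test the optimality condition of each leader at the other and add. The barrier terms combine
    into [t i ^+ 2 / (1 + t i)], the curvature terms have a favourable sign, and what remains is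
    [eta] times the first-order decrease at [x] of the newly added term. *)
Lemma leader_stability beta eta h b b' rho x x' (t : 'I_d -> R) :
  0 <= beta -> 0 < eta ->
  leader beta eta h b x -> leader beta eta (rho :: h) b' x' ->
  (forall i, t i = (x' 0 i - x 0 i) / x 0 i) ->
  \sum_i t i ^+ 2 / (1 + t i) <=
  \sum_i eta * ((1 + beta * (1 - dot x rho)) * (x 0 i * rho 0 i)
                + x 0 i * (b' 0 i - b 0 i)) * t i.
Proof.
move=> beta0 eta0 [sx x0 focx] [sx' x0' focx'] tdef.
have := focx _ sx'; have := focx' _ sx => {focx focx'}.
set e := x' - x; have xE : x' = x + e by rewrite /e addrC subrK.
have -> : x - x' = - e by rewrite opprB.
have -> : dquad beta (rho :: h) b' x' (- e) =
    (1 + beta * (1 - dot x' rho)) * dot e rho - dquad beta h b x' e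
    + dot e (b' - b).
  rewrite -scaleN1r dquadZ /dquad big_cons dotBr; ring.
have dx' : dquad beta h b x' e = dquad beta h b x e + beta * sqdots h e.
  apply/eqP; rewrite addrC -subr_eq {1}xE dquadB; apply/eqP.
  by congr (_ * _); apply: eq_bigr => r _; rewrite expr2.
have dotx' : dot x' rho = dot x rho + dot e rho by rewrite xE dotDl.
have tE i : t i ^+ 2 / (1 + t i) =
    (x' 0 i - x 0 i) / x 0 i + (x 0 i - x' 0 i) / x' 0 i.
  rewrite tdef; field.
  by rewrite !gt_eqF.
move=> f1 f2; under eq_bigr do rewrite tE.
rewrite big_split /=.
have -> : \sum_i eta * ((1 + beta * (1 - dot x rho)) * (x 0 i * rho 0 i)
    + x 0 i * (b' 0 i - b 0 i)) * t i =
    eta * ((1 + beta * (1 - dot x rho)) * dot e rho + dot e (b' - b)).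
  rewrite [dot e rho]/dot [dot e (b' - b)]/dot mulr_sumr -big_split mulr_sumr.
  apply: eq_bigr => i _; rewrite tdef !mxE /=.
  by field; rewrite gt_eqF.
set S1 := \sum_i _ in f2 *; set S2 := \sum_i _ in f1 *.
have key : eta^-1 * (S1 + S2) <=
    (1 + beta * (1 - dot x rho)) * dot e rho + dot e (b' - b).
  have := sqdots_ge0 h e; have := sqr_ge0 (dot e rho).
  move: f1 f2; rewrite dx' dotx' => f1 f2 q1 q2.
  have := mulr_ge0 beta0 q1; have := mulr_ge0 beta0 q2.
  nra.
by rewrite -ler_pdivrMl.
Qed.

(** With [tau] the norm of [t], the left side is at least [tau ^+ 2 / (1 + tau)] and, by
    Cauchy-Schwarz, the right side at most [alpha * tau]; hence [tau <= alpha * (1 + tau)]. *)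
Lemma self_bounding_sum (t a : 'I_d -> R) (alpha : R) :
  0 < alpha < 1 -> (forall i, - 1 < t i) ->
  \sum_i t i ^+ 2 / (1 + t i) <= \sum_i a i * t i ->
  \sum_i a i ^+ 2 <= alpha ^+ 2 ->
  \sum_i t i ^+ 2 <= (alpha / (1 - alpha)) ^+ 2.
Proof.
move=> /andP[al0 al1] tN1 ta aal; set S := \sum_i t i ^+ 2.
have S0 : 0 <= S by apply: sumr_ge0 => i _; exact: sqr_ge0.
pose tau := Num.sqrt S.
have tau2 : tau ^+ 2 = S by rewrite sqr_sqrtr.
have ttau i : t i <= tau.
  apply: le_trans (ler_norm _) _; rewrite -sqrtr_sqr ler_sqrt//.
  by rewrite /S (bigD1 i)//= lerDl; apply: sumr_ge0 => j _; exact: sqr_ge0.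
have : 0 <= tau by exact: sqrtr_ge0.
rewrite le_eqVlt => /predU1P[tau0|tau0].
  by rewrite -tau2 -tau0 expr0n sqr_ge0.
have tau1 : 0 < 1 + tau by lra.
have lb : S / (1 + tau) <= \sum_i t i ^+ 2 / (1 + t i).
  rewrite mulr_suml; apply: ler_sum => i _; rewrite ler_wpM2l ?sqr_ge0//.
  by rewrite lef_pV2 ?posrE//; have := ttau i; have := tN1 i; lra.
have cs : \sum_i a i * t i <= alpha * tau.
  have : 0 <= \sum_i (alpha * t i - tau * a i) ^+ 2.
    by apply: sumr_ge0 => i _; exact: sqr_ge0.
  have -> : \sum_i (alpha * t i - tau * a i) ^+ 2 =
      alpha ^+ 2 * S - 2 * alpha * tau * \sum_i a i * t i
      + tau ^+ 2 * \sum_i a i ^+ 2.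
    rewrite /S !mulr_sumr -sumrB -big_split /=.
    by apply: eq_bigr => i _; ring.
  rewrite -tau2; set W := \sum_i _ => h0.
  have at0 : 0 < alpha * tau by rewrite mulr_gt0.
  rewrite -(ler_pM2l at0); nra.
have tb : tau * (1 - alpha) <= alpha.
  have : S / (1 + tau) <= alpha * tau by lra.
  rewrite ler_pdivrMr// -tau2 => h0.
  rewrite -(ler_pM2l tau0); nra.
rewrite -tau2 ler_sqr ?nnegrE ?divr_ge0 ?sqrtr_ge0 ?(ltW al0)
  ?subr_ge0 ?(ltW al1)//.
by rewrite ler_pdivlMr// subr_gt0.
Qed.

(** The worst [z] is [c^-1], with [c] the slope. There the claim reads
    [s - s ^+ 2 / (2 * beta) <= ln c] for [s = beta * (1 - z')], which follows from
    [1 - c^-1 <= ln c] and [2 * beta <= c]; the latter is the hypothesis. *)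
Lemma surrogate_tangent (beta z z' : R) : 0 < beta -> 0 < z ->
  beta * (1 + z') <= 1 ->
  (1 - z') + beta / 2 * (1 - z') ^+ 2 - (1 + beta * (1 - z')) * (z - z')
    <= - ln z.
Proof.
move=> beta0 z0 bz; pose c := 1 + beta * (1 - z').
have c2 : 2 * beta <= c by rewrite /c; lra.
have c0 : 0 < c by lra.
have lc := ln_ge_sub1V c0.
have lcz : ln c + ln z <= c * z - 1.
  by rewrite -lnM ?posrE//; apply: ln_le_sub1; rewrite mulr_gt0.
have lc' : beta * (1 - z') - beta * (1 - z') ^+ 2 / 2 <= ln c.
  apply: le_trans lc; pose s := beta * (1 - z').
  have -> : 1 - c^-1 = s - s ^+ 2 / c.
    by rewrite /c -/s; field; rewrite -/c gt_eqF.
  rewrite lerD2l lerN2 ler_pdivrMr// /s.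
  have c2' : 0 <= c - 2 * beta by rewrite subr_ge0.
  have := mulr_ge0 (mulr_ge0 (ltW beta0) (sqr_ge0 (1 - z'))) c2'; nra.
rewrite -/c; move: lcz lc'; rewrite /c; nra.
Qed.

(** The tangents at [u'] add up to [quad] plus [dquad], and optimality of [u'] trades [dquad] for
    the difference of barriers. *)
Lemma leader_comparator beta eta h u u' : 0 < beta -> 0 < eta ->
  leader beta eta h 0 u' ->
  (forall rho, rho \in h -> beta * (1 + dot u' rho) <= 1) ->
  simplex u -> (forall i, 0 < u 0 i) ->
  (forall rho, rho \in h -> 0 < dot u rho) ->
  quad beta h 0 u' + eta^-1 * logbar u' <=
  - (\sum_(rho <- h) ln (dot u rho)) + eta^-1 * logbar u.
Proof.
move=> beta0 eta0 [su' u0' foc] hu' su u0 hu.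
have {foc} := foc _ su; set S := \sum_i _ => foc.
have lnu : logbar u' - logbar u <= S.
  rewrite /logbar opprK addrC -sumrB; apply: ler_sum => i _.
  have -> : ln (u 0 i) - ln (u' 0 i) = ln (u 0 i / u' 0 i).
    by rewrite ln_div ?posrE.
  have -> : (u 0 i - u' 0 i) / u' 0 i = u 0 i / u' 0 i - 1.
    by rewrite mulrBl divff// gt_eqF.
  by apply: ln_le_sub1; rewrite divr_gt0.
have tang : quad beta h 0 u' + dquad beta h 0 u' (u - u') <=
    - (\sum_(rho <- h) ln (dot u rho)).
  rewrite /quad /dquad !dot0r !subr0 -sumrB -sumrN big_seq [leRHS]big_seq.
  apply: ler_sum => rho rh; rewrite dotBl.
  apply: surrogate_tangent => //; [exact: hu|exact: hu'].
have := ler_wpM2l (ltW (_ : 0 < eta^-1)) lnu; rewrite invr_gt0 => /(_ eta0).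
lra.
Qed.

(** In the vertex test a round with [D = dot u rho] contributes at most [(1 + beta - beta * D) * D],
    a quadratic in [D] with maximum [(1 + beta) ^+ 2 / (4 * beta)]. *)
Lemma leader_lower_bound beta eta h u i : 0 < beta -> 0 < eta ->
  leader beta eta h 0 u ->
  (forall rho, rho \in h -> 0 <= rho 0 i /\ beta * dot u rho <= 1 + beta) ->
  (u 0 i)^-1 <= d%:R + eta * ((size h)%:R * ((1 + beta) ^+ 2 / (4 * beta))).
Proof.
move=> beta0 eta0 lu hu; have := leader_vertex i lu.
have : dquad beta h 0 u (delta_mx 0 i - u) <=
    (size h)%:R * ((1 + beta) ^+ 2 / (4 * beta)).
  rewrite /dquad dot0r subr0 -sumrN.
  rewrite -sum1_size natr_sum mulr_suml big_seq [leRHS]big_seq.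
  apply: ler_sum => rho /hu [r0 bu]; rewrite mul1r dotBl dot_delta.
  rewrite ler_pdivlMr ?mulr_gt0//.
  have w0 : 0 <= 1 + beta * (1 - dot u rho) by lra.
  have := mulr_ge0 (mulr_ge0 w0 r0) (ltW beta0).
  have := sqr_ge0 (1 + beta - 2 * (beta * dot u rho)).
  nra.
set W := _ * (_ / _) => h1 h2.
have := le_trans h2 h1; rewrite ler_pdivrMl//; lra.
Qed.

End LeaderInequalities.

(** * Gram matrices and the elliptical potential *)

Section EllipticalPotential.
Context {R : realType} {d : nat}.
Implicit Types (rho v w e : 'rV[R]_d) (h : seq 'rV[R]_d).

(** The matrix determinant lemma: multiplying one block matrix by the same unit triangular matrix on
    the left and on the right gives two triangular matrices of equal determinant. *)
Lemma det_add_rank1 (A : 'M[R]_d) (u v : 'rV[R]_d) : A \in unitmx ->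
  \det (A + u^T *m v) = \det A * (1 + (v *m invmx A *m u^T) 0 0).
Proof.
move=> Au; pose w := invmx A *m u^T.
have -> : A + u^T *m v = A *m (1%:M + w *m v).
  by rewrite mulmxDr mulmx1 /w !mulmxA mulmxV// mul1mx.
rewrite det_mulmx -mulmxA -/w; congr (_ * _).
have h1 : block_mx (1%:M : 'M[R]_1) 0 (- w) 1%:M *m block_mx 1%:M (- v) w 1%:M
    = block_mx 1%:M (- v) 0 (1%:M + w *m v).
  rewrite mulmx_block !mul1mx !mul0mx !mulmx1 !addr0 addNr.
  by rewrite mulNmx mulmxN opprK addrC.
have h2 : block_mx (1%:M : 'M[R]_1) (- v) w 1%:M *m block_mx 1%:M 0 (- w) 1%:M
    = block_mx (1%:M + v *m w) (- v) 0 1%:M.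
  rewrite mulmx_block !mul1mx !mulmx0 !mulmx1 !add0r addrN.
  by rewrite mulNmx mulmxN opprK.
have := congr1 (@determinant _ _) h1; have := congr1 (@determinant _ _) h2.
rewrite !det_mulmx !det_ublock !det_lblock !det1 !mul1r !mulr1 => -> <-.
by rewrite det_mx11 !mxE eqxx.
Qed.

Definition gram (a : R) h : 'M[R]_d := a%:M + \sum_(rho <- h) rho^T *m rho.

Definition gramform (a : R) h v w : R :=
  a * dot v w + \sum_(rho <- h) dot v rho * dot w rho.

Lemma dot_mulmx v w : dot v w = (v *m w^T) 0 0.
Proof. by rewrite mxE; apply: eq_bigr => i _; rewrite mxE. Qed.

Lemma gram_cons a rho h : gram a (rho :: h) = gram a h + rho^T *m rho.
Proof. by rewrite /gram big_cons addrA addrAC. Qed.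

Lemma gramform_mulmx a h v w : gramform a h v w = (v *m gram a h *m w^T) 0 0.
Proof.
elim: h => [|rho h IHh].
  rewrite /gramform /gram !big_nil !addr0 mul_mx_scalar -scalemxAl mxE.
  by rewrite dot_mulmx.
rewrite gram_cons mulmxDr mulmxDl [RHS]mxE -IHh /gramform big_cons.
rewrite [in RHS]mulmxA -mulmxA [in RHS]mxE big_ord1 -dot_mulmx.
rewrite -[in RHS](trmxK rho) -trmx_mul trmxK [in RHS]mxE -dot_mulmx.
ring.
Qed.

Lemma gramform_ge0 a h v : 0 <= a -> 0 <= gramform a h v v.
Proof.
move=> a0; apply: addr_ge0.
  by apply: mulr_ge0 => //; apply: sumr_ge0 => i _; rewrite -expr2 sqr_ge0.
by apply: sumr_ge0 => rho _; rewrite -expr2 sqr_ge0.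
Qed.

Lemma gram_sym a h : (gram a h)^T = gram a h.
Proof.
rewrite /gram linearD /= tr_scalar_mx; congr (_ + _).
by rewrite linear_sum /=; apply: eq_bigr => rho _; rewrite trmx_mul trmxK.
Qed.

(** [y] represents the functional [dot _ rho] in the inner product [gramform a h]. *)
Lemma gram_inv_form a h rho : gram a h \in unitmx ->
  let y := rho *m invmx (gram a h) in
  (forall e, gramform a h e y = dot e rho) /\
  gramform a h y y = (rho *m invmx (gram a h) *m rho^T) 0 0.
Proof.
move=> Au y; have ey e : gramform a h e y = dot e rho.
  rewrite gramform_mulmx dot_mulmx /y trmx_mul trmx_inv gram_sym -mulmxA.
  by rewrite mulKVmx.
by split=> //; rewrite ey dot_mulmx.
Qed.

Lemma det_gram_gt0 a h : 0 < a -> 0 < \det (gram a h).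
Proof.
move=> a0; elim: h => [|rho h IHh].
  by rewrite /gram big_nil addr0 det_scalar exprn_gt0.
have Au : gram a h \in unitmx by rewrite unitmxE unitfE gt_eqF.
rewrite gram_cons det_add_rank1// mulr_gt0//.
have [_ <-] := gram_inv_form rho Au.
have := gramform_ge0 h (rho *m invmx (gram a h)) (ltW a0); lra.
Qed.

(** Young's inequality in the inner product of the new Gram matrix, applied to [e] and the
    representative [y] of [rho]. Removing [rho] multiplies the determinant by [1 - q], where [q] is
    the squared norm of [y], and [q <= - ln (1 - q)]. *)
Lemma dot_le_log_det a h rho e (mu : R) : 0 < a -> 0 < mu ->
  dot e rho <= mu / 2 * gramform a (rho :: h) e e
    + (2 * mu)^-1 * (ln (\det (gram a (rho :: h))) - ln (\det (gram a h))).
Proof.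
move=> a0 mu0; set A := gram a (rho :: h).
have dA : 0 < \det A by exact: det_gram_gt0.
have dA0 := det_gram_gt0 h a0.
have Au : A \in unitmx by rewrite unitmxE unitfE gt_eqF.
have [ey yy] := gram_inv_form rho Au; rewrite -/A in ey yy.
set y := rho *m invmx A in ey yy; set q := gramform _ _ y y in yy.
have qle : q <= ln (\det A) - ln (\det (gram a h)).
  have : \det (gram a h) = \det A * (1 - q).
    have -> : gram a h = A + (- rho)^T *m rho.
      by rewrite /A gram_cons linearN /= mulNmx addrK.
    by rewrite det_add_rank1// linearN /= mulmxN [X in 1 + X]mxE -yy.
  move=> dq; have q1 : 0 < 1 - q by rewrite -(pmulr_rgt0 _ dA) -dq.
  rewrite dq lnM ?posrE//; have := ln_le_sub1 q1; lra.
have expand : gramform a (rho :: h) (e - mu^-1 *: y) (e - mu^-1 *: y) =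
    gramform a (rho :: h) e e - 2 * mu^-1 * dot e rho + mu^-1 ^+ 2 * q.
  rewrite -ey /q /gramform; rewrite !dotBl !dotBr !dotZl !dotZr (dotC y e).
  have -> : \sum_(r <- rho :: h)
      dot (e - mu^-1 *: y) r * dot (e - mu^-1 *: y) r =
    \sum_(r <- rho :: h) dot e r * dot e r
    - 2 * mu^-1 * (\sum_(r <- rho :: h) dot e r * dot y r)
    + mu^-1 ^+ 2 * (\sum_(r <- rho :: h) dot y r * dot y r).
    rewrite !mulr_sumr -sumrB -big_split /=; apply: eq_bigr => r _.
    by rewrite dotBl dotZl; ring.
  by ring.
have := gramform_ge0 (rho :: h) (e - mu^-1 *: y) (ltW a0).
rewrite expand => {expand} ge0.
have mu20 : 0 < mu / 2 by rewrite divr_gt0.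
have := mulr_ge0 (ltW mu20) ge0.
set Q := gramform _ _ e e.
have -> : mu / 2 * (Q - 2 * mu^-1 * dot e rho + mu^-1 ^+ 2 * q) =
    mu / 2 * Q - dot e rho + (2 * mu)^-1 * q.
  by field; rewrite gt_eqF.
have : (2 * mu)^-1 * q <= (2 * mu)^-1 * (ln (\det A) - ln (\det (gram a h))).
  by rewrite ler_wpM2l// invr_ge0 mulr_ge0// ltW.
lra.
Qed.

Lemma fact_le_exp n : (n`! <= n ^ n)%N.
Proof.
elim: n => // n IHn; rewrite factS expnS leq_mul2l /=.
by apply: leq_trans IHn _; case: n => // n; rewrite leq_exp2r.
Qed.

(** The Leibniz formula, with the number of permutations bounded by [d ^ d]. *)
Lemma det_le_entries (A : 'M[R]_d) (M : R) : 0 <= M ->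
  (forall i j, `|A i j| <= M) -> \det A <= (d%:R * M) ^+ d.
Proof.
move=> M0 AM; apply: le_trans (ler_norm _) _.
apply: le_trans (ler_norm_sum _ _ _) _.
have : forall s : 'S_d, true -> `|(-1) ^+ s * \prod_i A i (s i)| <= M ^+ d.
  move=> s _; rewrite normrM normrX normrN1 expr1n mul1r normr_prod.
  apply: (@le_trans _ _ (\prod_(i < d) M)); last first.
    by rewrite prodr_const card_ord.
  by apply: ler_prod => i _; rewrite normr_ge0 AM.
move=> /(ler_sum _) /le_trans -> //.
rewrite sumr_const -[X in X <= _]mulr_natl exprMn ler_wpM2r ?exprn_ge0//.
by rewrite card_Sn -natrX ler_nat fact_le_exp.
Qed.

Lemma log_det_gram_le a h (P : R) : 0 < a -> (0 < d)%N ->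
  (forall rho, rho \in h -> forall i, 0 <= rho 0 i <= P) ->
  ln (\det (gram a h)) - ln (\det (gram a [::])) <=
  d%:R * ln (d%:R * (1 + (size h)%:R * P ^+ 2 / a)).
Proof.
move=> a0 d0 hP; set M := a + (size h)%:R * P ^+ 2.
have M0 : 0 < M.
  by rewrite ltr_wpDr// mulr_ge0 ?sqr_ge0.
have dR : (0 : R) < d%:R by rewrite ltr0n.
have detM : \det (gram a h) <= (d%:R * M) ^+ d.
  apply: det_le_entries (ltW M0) _ => i j.
  rewrite /gram mxE; apply: le_trans (ler_normD _ _) _; apply: lerD.
    by rewrite mxE; case: (i == j);
      rewrite ?mulr1n ?mulr0n ?normr0 ?gtr0_norm// ltW.
  rewrite summxE; apply: le_trans (ler_norm_sum _ _ _) _.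
  rewrite -sum1_size natr_sum mulr_suml big_seq [leRHS]big_seq.
  apply: ler_sum => rho /hP rP; rewrite mul1r !mxE big_ord1 !mxE.
  have /andP[ri riP] := rP i; have /andP[rj rjP] := rP j.
  by rewrite normrM !ger0_norm// expr2 ler_pM.
have -> : gram a [::] = a%:M by rewrite /gram big_nil addr0.
rewrite det_scalar.
have dt := det_gram_gt0 h a0.
have : ln (\det (gram a h)) <= ln ((d%:R * M) ^+ d).
  by rewrite ler_ln ?posrE// exprn_gt0// mulr_gt0.
have -> : d%:R * M = a * (d%:R * (1 + (size h)%:R * P ^+ 2 / a)).
  by rewrite /M; field; rewrite gt_eqF.
have pos : 0 < d%:R * (1 + (size h)%:R * P ^+ 2 / a).
  rewrite mulr_gt0// ltr_wpDr// divr_ge0 ?(ltW a0)// mulr_ge0 ?sqr_ge0//.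
set X := d%:R * _ in pos *.
rewrite exprMn lnM ?posrE ?exprn_gt0// (lnXn _ pos) -mulr_natl; lra.
Qed.

End EllipticalPotential.

(** * Closed form of the surrogate losses *)

Section Surrogate.
Context {R : realType} {d : nat}.
Implicit Types (x y z r b rho : 'rV[R]_d) (h : seq 'rV[R]_d).

Lemma gradient_loss r z : 0 < dot z r ->
  gradient (fun y => fine (loss r y)) z = - (dot z r)^-1 *: r.
Proof.
move=> zr; apply/rowP => i; rewrite !mxE.
pose phi s : R := fine (- lne (s * r 0 i + dot z r)%:E)%E.
have -> : 'D_(delta_mx 0 i) (fun y => fine (loss r y)) z =
    @derive R R^o R^o phi 0 1.
  rewrite /derive.
  apply: (congr1 (fun F : R -> R => lim (F h @[h --> (0 : R)^']))%classic).
  apply/funext => h /=.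
  rewrite /phi /loss addr0 mul0r add0r dotDl dotZl dot_delta.
  by rewrite [h *: (1 : R^o)]mulr1.
apply: derive_val.
pose g s : R := s * r 0 i + dot z r.
have g0 : g 0 = dot z r by rewrite /g mul0r add0r.
have g0' : 0 < g 0 by rewrite g0.
have hd : is_derive (0 : R) 1 g (r 0 i).
  have -> : g = (fun s : R => s * r 0 i) + cst (dot z r) by [].
  by apply: is_derive_eq; rewrite scaler0 add0r addr0 /GRing.scale /= mulr1.
have lnd := is_derive1_comp (is_derive1_ln g0') hd.
have : is_derive (0 : R) 1 (- (@ln R \o g)) (- (dot z r)^-1 * r 0 i).
  by apply: is_derive_eq; rewrite g0 mulNr.
apply: near_eq_is_derive.
have gc : continuous_at 0 g.
  apply: continuous_add; last exact: cst_continuous.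
  by apply: continuous_mul; [exact: cvg_id|exact: cst_continuous].
(* Only where [g] is positive does the finite part of the extended loss agree with [- ln]. *)
have : \forall s \near (0 : R), 0 < g s by apply: cvgr_gt gc _ _; rewrite g0.
apply: filterS => s gs.
by rewrite /phi lne_EFin.
Qed.

Lemma dot_gt0 x r : (forall i, 0 < x 0 i) -> simplex r -> 0 < dot x r.
Proof.
move=> x0 [r0 r1]; rewrite lt_neqAle eq_sym psumr_neq0; last first.
  by move=> i _; rewrite mulr_ge0// ltW.
rewrite sumr_ge0 ?andbT; last by move=> i _; rewrite mulr_ge0// ltW.
have : \sum_i r 0 i != 0 by rewrite r1 oner_eq0.
rewrite psumr_neq0// => /hasP[i _ ri]; apply/hasP; exists i => //.
by rewrite /= mulr_gt0.
Qed.

Lemma surrogateE beta r z y : 0 < dot z r ->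
  let rho := (dot z r)^-1 *: r in
  surrogate beta r z y =
  - ln (dot z r) + ((1 - dot y rho) + beta / 2 * (1 - dot y rho) ^+ 2).
Proof.
move=> zr rho; rewrite /surrogate gradient_loss// {1}/loss lne_EFin//=.
rewrite scaleNr dotNr -/rho.
have -> : - dot (y - z) rho = 1 - dot y rho.
  by rewrite dotBl opprB; congr (_ - _); rewrite /rho dotZr mulVf ?gt_eqF.
by rewrite -addrA.
Qed.

End Surrogate.

(** * Bounds through the running maxima [p] *)

Section Comparison.
Context {R : realType} {d : nat}.
Implicit Types (p x u rho : 'rV[R]_d).

(** [dot u rho] combines the products [u 0 i * p 0 i] with weights [rho 0 i / p 0 i] of total at
    most 1. *)
Lemma dot_le_of_prices rho p u (k : R) : 0 <= k -> (forall i, 0 <= rho 0 i) ->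
  (forall i, 0 < p 0 i) -> \sum_i rho 0 i / p 0 i <= 1 ->
  (forall i, u 0 i * p 0 i <= k) -> dot u rho <= k.
Proof.
move=> k0 r0 p0 rp1 upk.
apply: (@le_trans _ _ (k * \sum_i rho 0 i / p 0 i)).
  rewrite mulr_sumr; apply: ler_sum => i _.
  have -> : u 0 i * rho 0 i = (u 0 i * p 0 i) * (rho 0 i / p 0 i).
    by field; rewrite gt_eqF.
  by rewrite ler_wpM2r// divr_ge0// ltW.
by rewrite ler_piMr.
Qed.

Lemma update_p_ge p x i : p 0 i <= update_p p x 0 i.
Proof. by rewrite mxE le_max lexx. Qed.

Lemma update_p_geV p x i : (x 0 i)^-1 <= update_p p x 0 i.
Proof. by rewrite mxE le_max lexx orbT. Qed.

Lemma mul_update_pB p x i : 0 < p 0 i -> 0 < x 0 i ->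
  x 0 i * (update_p p x 0 i - p 0 i) = 1 - p 0 i / update_p p x 0 i.
Proof.
move=> p0 x0; rewrite mxE maxEle; case: ifP => _; last first.
  by rewrite subrr mulr0 divff ?subrr// gt_eqF.
by field; rewrite gt_eqF.
Qed.

(** A price rises only when [x'] falls below [(p 0 i)^-1], itself at most [x 0 i], so its relative
    move is dominated by that of the play. *)
Lemma update_p_drop p x x' i : 0 < p 0 i -> 0 < x 0 i -> 0 < x' 0 i ->
  (x 0 i)^-1 <= p 0 i ->
  0 <= 1 - p 0 i / update_p p x' 0 i <= `|(x' 0 i - x 0 i) / x 0 i|.
Proof.
move=> p0 x0 x'0 xp; have p'0 : 0 < update_p p x' 0 i.
  exact: lt_le_trans (update_p_ge _ _ _).
rewrite subr_ge0 ler_pdivrMr// mul1r update_p_ge /=.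
rewrite mxE maxEle; case: ifP => _; last by rewrite divff ?subrr// gt_eqF.
rewrite invrK -normrN; apply: le_trans (ler_norm _).
have -> : - ((x' 0 i - x 0 i) / x 0 i) = 1 - x' 0 i / x 0 i.
  by field; rewrite gt_eqF.
by rewrite lerD2l lerN2 mulrC ler_wpM2r// ltW.
Qed.

End Comparison.

(** * The invariant of an epoch and its preservation in a round *)

Section Epoch.
Context {R : realType} {d : nat} (T : nat) (B eta beta : R).
Context (d_gt0 : (0 < d)%N) (dT : (110 * d <= T)%N) (B_ge : 52 <= B)
  (etaB : eta * B = 1 / 4) (betaB : beta * B = 11 / 7).
Implicit Types (x y z u b rho r p : 'rV[R]_d) (h : seq 'rV[R]_d).

(* [7 / 22 * B = 1 / (2 * beta)] is the reset threshold for [u_i p_i], and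
   [u_i >= 10 / T]. *)
Definition price_cap : R := 7 / 22 * B * (T%:R / 10).

(* Chosen so that the quadratic lower bound [t^2 / (6 eta)] on the barrier
   equals [beta / 2 * gram_shift * t^2]. *)
Definition gram_shift : R := (3 * eta * beta)^-1.

(* [h] lists the scaled returns vectors [r_s / <x_s, r_s>] of the epoch. *)
Record epoch_inv (s : bisons_state) h : Prop := EpochInv {
  inv_fhats : exists c, forall y,
    \sum_(g <- fhats s) g y = c + quad beta h 0 y;
  inv_gs : exists c, forall y, \sum_(g <- gs s) g y =
    c + quad beta h (B *: (p_prev s - const_mx d%:R)) y;
  inv_play : leader beta eta h (B *: (p_prev s - const_mx d%:R)) (play s);
  inv_move : \sum_i (1 - p_prev s 0 i / update_p (p_prev s) (play s) 0 i) ^+ 2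
    <= 4 * eta ^+ 2;
  inv_price : forall i, d%:R <= p_prev s 0 i <= price_cap;
  inv_returns : forall rho, rho \in h ->
    [/\ forall i, 0 <= rho 0 i, \sum_i rho 0 i / p_prev s 0 i <= 1 &
        forall x, (forall i, 0 < x 0 i) -> 0 < dot x rho];
  inv_value : eta^-1 * (d%:R * ln d%:R)
    - 7 / 22 * B * (ln (\det (gram gram_shift h))
                    - ln (\det (gram gram_shift [::] : 'M[R]_d)))
    - 5 / 4 * B * \sum_i ln (p_prev s 0 i / d%:R)
    <= quad beta h (B *: (p_prev s - const_mx d%:R)) (play s)
       + eta^-1 * logbar (play s)
}.

(** The state does not store the surrogate leader, hence the quantifier over [u]. The bound is the
    failed reset test with the factor [1 + 6 * eta] weakened to 1. *)
Definition no_reset (s : @bisons_state R d) h : Prop :=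
  exists2 u, leader beta eta h 0 u &
    forall i, u 0 i * update_p (p_prev s) (play s) 0 i <= 7 / 22 * B.

Let B0 : 0 < B. Proof. by have := B_ge; lra. Qed.
Let eta0 : 0 < eta.
Proof. by rewrite -(pmulr_lgt0 _ B0) etaB; have := B_ge; lra. Qed.
Let beta0 : 0 < beta.
Proof. by rewrite -(pmulr_lgt0 _ B0) betaB; have := B_ge; lra. Qed.
Let eta_le : eta <= 1 / 200.
Proof. by rewrite -(ler_pM2r B0) etaB; have := B_ge; lra. Qed.
Let beta_le : beta <= 4 / 100.
Proof. by rewrite -(ler_pM2r B0) betaB; have := B_ge; lra. Qed.
Let dR : (0 : R) < d%:R. Proof. by rewrite ltr0n. Qed.
Let dTR : 110 * d%:R <= T%:R :> R.
Proof. by rewrite -natrM ler_nat. Qed.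
Let shift0 : 0 < gram_shift.
Proof. by rewrite invr_gt0 !mulr_gt0. Qed.

Lemma epoch_inv_init :
  epoch_inv (@bisons_init R d) [::] /\ no_reset (@bisons_init R d) [::].
Proof.
have lead := argmin_barrier_leader d_gt0 (ltW beta0) eta0.
have playE := leader_nil eta0 lead.
have pp : B *: (const_mx d%:R - const_mx d%:R : 'rV[R]_d) = 0.
  by rewrite subrr scaler0.
have pE : update_p (const_mx d%:R) (argmin barrier) = const_mx d%:R :> 'rV[R]_d.
  by apply/rowP => i; rewrite !mxE playE invrK maxxx.
have dB : d%:R <= price_cap.
  rewrite /price_cap; have := dTR; have := dR; have := B_ge; nra.
split.
  split=> /=; rewrite ?pp ?pE//.
  - by exists 0 => y; rewrite quad_nil big_nil addr0.
  - by exists 0 => y; rewrite quad_nil big_nil addr0.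
  - rewrite big1 => [|i _]; first by have := sqr_ge0 eta; lra.
    by rewrite mxE divff ?gt_eqF// subrr expr0n.
  - by move=> i; rewrite mxE lexx dB.
  - rewrite subrr mulr0 subr0 quad_nil add0r [X in 5 / 4 * B * X]big1.
      rewrite mulr0 subr0 /logbar (eq_bigr (fun=> - ln d%:R)) => [|i _].
        by rewrite sumr_const card_ord mulNrn opprK mulr_natl.
      by rewrite playE lnV.
    by move=> i _; rewrite mxE divff ?ln1 ?gt_eqF.
exists (argmin barrier) => //= i; rewrite pE mxE playE mulVf ?gt_eqF//.
by have := B_ge; lra.
Qed.

Section Round.
Context (s : @bisons_state R d) (h : seq 'rV[R]_d) (r : 'rV[R]_d).
Context (hinv : epoch_inv s h) (hs : no_reset s h) (sr : simplex r)
  (size_h : (size h < T)%N).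

Let x := play s.
Let q := p_prev s.
Let p := update_p q x.
Let rho := (dot x r)^-1 *: r.

Let x0 i : 0 < x 0 i. Proof. by have [_] := inv_play hinv. Qed.
Let xr0 : 0 < dot x r. Proof. exact: dot_gt0. Qed.
Let q0 i : 0 < q 0 i.
Proof. by have /andP[+ _] := inv_price hinv i; apply: lt_le_trans. Qed.
Let p0 i : 0 < p 0 i.
Proof. exact: lt_le_trans (update_p_ge _ _ _). Qed.
Let qp i : q 0 i <= p 0 i. Proof. exact: update_p_ge. Qed.
Let xp i : (x 0 i)^-1 <= p 0 i. Proof. exact: update_p_geV. Qed.
Let xrho : dot x rho = 1.
Proof. by rewrite /rho dotZr mulVf// gt_eqF. Qed.
Let rho0 i : 0 <= rho 0 i.
Proof. by rewrite mxE mulr_ge0 ?invr_ge0 ?(ltW xr0)//; exact: sr.1. Qed.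
Let x1 i : x 0 i <= 1.
Proof. by have [sx _ _] := inv_play hinv; exact: simplex_le1. Qed.

Let e i := 1 - q 0 i / p 0 i.
Let eE i : e i = x 0 i * (p 0 i - q 0 i).
Proof. by rewrite mul_update_pB. Qed.
Let e0 i : 0 <= e i.
Proof. by rewrite /e subr_ge0 ler_pdivrMr// mul1r. Qed.

Lemma round_returns rho' : rho' \in rho :: h ->
  [/\ forall i, 0 <= rho' 0 i, \sum_i rho' 0 i / p 0 i <= 1 &
      forall z, (forall i, 0 < z 0 i) -> 0 < dot z rho'].
Proof.
rewrite inE => /predU1P[->|/(inv_returns hinv)[r0 rq rz]]; split=> //.
- rewrite -xrho; apply: ler_sum => i _; rewrite mulrC ler_wpM2r//.
  by rewrite -[leRHS]invrK lef_pV2 ?posrE ?invr_gt0.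
- by move=> z z0; rewrite /rho dotZr mulr_gt0 ?invr_gt0//; exact: dot_gt0.
- apply: le_trans rq; apply: ler_sum => i _; rewrite ler_wpM2l//.
  by rewrite lef_pV2 ?posrE.
Qed.

Lemma round_price i : d%:R <= p 0 i <= price_cap.
Proof.
have /andP[dq _] := inv_price hinv i; rewrite (le_trans dq)//=.
have [u lu up] := hs; have [_ u0 _] := lu.
have uV : (u 0 i)^-1 <= T%:R / 10.
  apply: le_trans (leader_lower_bound (i := i) beta0 eta0 lu _) _
    => [rho' hrho'|].
    have [|r0 r1 _] := @round_returns rho'; first by rewrite inE hrho' orbT.
    split=> //; have : dot u rho' <= 7 / 22 * B.
      by apply: dot_le_of_prices r0 _ r1 up => //; have := B_ge; lra.
    by move=> /(ler_wpM2l (ltW beta0)); have := betaB; have := beta0; lra.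
  have szT : (size h)%:R <= T%:R :> R by rewrite ler_nat ltnW.
  have -> : eta * ((size h)%:R * ((1 + beta) ^+ 2 / (4 * beta))) =
      (size h)%:R * (7 / 176 * (1 + beta) ^+ 2).
    rewrite (_ : eta = 7 / 44 * beta); last first.
      by apply: (mulIf (lt0r_neq0 B0)); have := etaB; have := betaB; lra.
    by field; rewrite gt_eqF.
  have : (1 + beta) ^+ 2 <= 11 / 10 by have := beta_le; have := beta0; nra.
  have : 0 <= (size h)%:R :> R by [].
  have := dTR; have := dR; have := sqr_ge0 (1 + beta); nra.
have := up i; rewrite -ler_pdivlMl// => /le_trans; apply.
by rewrite /price_cap mulrC ler_wpM2l//; have := B_ge; lra.
Qed.

Context (x' : 'rV[R]_d).
Context (lx' :
  leader beta eta (rho :: h) (B *: (p - const_mx d%:R)) x').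

Let t i := (x' 0 i - x 0 i) / x 0 i.
Let x'0 i : 0 < x' 0 i. Proof. by have [] := lx'. Qed.

(** The bound reproduces itself: [inv_move] gives it for the last relative price moves [e], so the
    coefficients [a] of the next step have norm at most [3 / 2 * eta], and the self-bounding
    inequality returns [2 * eta]. *)
Lemma play_stability : \sum_i t i ^+ 2 <= 4 * eta ^+ 2.
Proof.
pose a i := eta * (x 0 i * rho 0 i) + 1 / 4 * e i.
have tN1 i : - 1 < t i.
  rewrite /t ltr_pdivlMr// mulN1r ltrBrDl subrr; exact: x'0.
apply: le_trans (@self_bounding_sum _ _ t a (3 / 2 * eta) _ tN1 _ _) _.
- by have := eta0; have := eta_le; lra.
- apply: le_trans (leader_stability (ltW beta0) eta0 (inv_play hinv) lx'
    (t := t) _) _ => //.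
  rewrite le_eqVlt; apply/orP; left; apply/eqP; apply: eq_bigr => i _.
  rewrite -/x xrho subrr mulr0 addr0 mul1r /a eE -/q; congr (_ * _).
  rewrite !mxE -etaB; ring.
(* The weights [x 0 i * rho 0 i] sum to 1, so the total is at most [(3 / 2 + 3 / 4) * eta ^+ 2], the
   square of [3 / 2 * eta]. *)
- apply: (@le_trans _ _ (\sum_i (3 / 2 * eta ^+ 2 * (x 0 i * rho 0 i)
      + 3 / 16 * e i ^+ 2))).
    apply: ler_sum => i _; rewrite /a.
    have xr1 : x 0 i * rho 0 i <= 1.
      rewrite -xrho /dot (bigD1 i)//= lerDl; apply: sumr_ge0 => j _.
      by rewrite mulr_ge0// ltW.
    have xrg : 0 <= x 0 i * rho 0 i by rewrite mulr_ge0// ltW.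
    have := sqr_ge0 (eta * (x 0 i * rho 0 i) - 1 / 2 * e i).
    have : eta ^+ 2 * (x 0 i * rho 0 i) ^+ 2 <= eta ^+ 2 * (x 0 i * rho 0 i).
      by rewrite ler_wpM2l ?sqr_ge0// expr2 ler_piMr.
    nra.
  rewrite big_split /= -!mulr_sumr -/(dot x rho) xrho.
  have := inv_move hinv; rewrite -/q -/x -/p -/(\sum_i e i ^+ 2).
  lra.
rewrite (_ : 4 * eta ^+ 2 = (2 * eta) ^+ 2); last by ring.
have e1 : 0 < 1 - 3 / 2 * eta by have := eta_le; lra.
rewrite ler_sqr ?nnegrE ?divr_ge0 ?mulr_ge0 ?(ltW eta0) ?(ltW e1)//.
rewrite ler_pdivrMr//; have := eta0; have := eta_le; nra.
Qed.

Let t_bound i : `|t i| <= 2 * eta.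
Proof.
rewrite -ler_sqr ?nnegrE ?mulr_ge0 ?(ltW eta0)// real_normK ?num_real//.
have -> : (2 * eta) ^+ 2 = 4 * eta ^+ 2 by ring.
apply: le_trans play_stability; rewrite (bigD1 i)//= lerDl.
by apply: sumr_ge0 => j _; exact: sqr_ge0.
Qed.

Let drop i := update_p_drop (p0 i) (x0 i) (x'0 i) (xp i).

Lemma round_move :
  \sum_i (1 - p 0 i / update_p p x' 0 i) ^+ 2 <= 4 * eta ^+ 2.
Proof.
apply: le_trans play_stability; apply: ler_sum => i _.
have /andP[d0 dt] := drop i.
by rewrite -[leRHS]real_normK ?num_real// ler_sqr ?nnegrE.
Qed.

(** Needed at a reset: the test reads the updated price, while the regret bound only contains
    [p]. *)
Lemma round_price_growth i : 99 / 100 * update_p p x' 0 i <= p 0 i.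
Proof.
have /andP[_ /le_trans/(_ (t_bound i)) dt] := drop i.
rewrite -ler_pdivlMr; last exact: lt_le_trans (update_p_ge _ _ _).
have := eta_le; lra.
Qed.

(** The new loss lowers the value by [dot z rho]. [dot_le_log_det] with [mu = beta] bounds this by
    the log-determinant increment plus a quadratic form, whose three parts are paid by the barrier,
    the new surrogate and the past surrogates. *)
Lemma round_value : eta^-1 * (d%:R * ln d%:R)
    - 7 / 22 * B * (ln (\det (gram gram_shift (rho :: h)))
                    - ln (\det (gram gram_shift [::] : 'M[R]_d)))
    - 5 / 4 * B * \sum_i ln (p 0 i / d%:R)
    <= quad beta (rho :: h) (B *: (p - const_mx d%:R)) x'
       + eta^-1 * logbar x'.
Proof.
have [sx' _ _] := lx'.
have := leader_strong_min (t := t) (inv_play hinv) sx' x'0 (fun=> erefl).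
have := inv_value hinv; rewrite -/x -/q.
move=> hV; set z := x' - x.
have := dot_le_log_det h rho z shift0 beta0.
have -> : quad beta (rho :: h) (B *: (p - const_mx d%:R)) x' =
    quad beta h (B *: (q - const_mx d%:R)) x' - dot z rho
    + beta / 2 * dot z rho ^+ 2
    - B * \sum_i e i * (1 + t i).
  have -> : \sum_i e i * (1 + t i) = dot x' (p - q).
    rewrite /dot; apply: eq_bigr => i _.
    rewrite eE /t [(p - q) 0 i]mxE [(- q) 0 i]mxE.
    by field; rewrite gt_eqF.
  have -> : dot z rho = dot x' rho - 1 by rewrite /z dotBl xrho.
  by rewrite /quad big_cons !dotZr !dotBr; ring.
(* The bias telescopes through [e i <= ln (p 0 i / q 0 i)]; the factor [5 / 4] covers
   [1 + t i <= 1 + 2 * eta]. *)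
have : B * \sum_i e i * (1 + t i) <=
    B * (5 / 4 * (\sum_i ln (p 0 i / d%:R) - \sum_i ln (q 0 i / d%:R))).
  rewrite ler_wpM2l ?(ltW B0)// -sumrB mulr_sumr; apply: ler_sum => i _.
  have -> : ln (p 0 i / d%:R) - ln (q 0 i / d%:R) = ln (p 0 i / q 0 i).
    by rewrite !ln_div ?posrE//; ring.
  have el : e i <= ln (p 0 i / q 0 i).
    by apply: le_trans (ln_ge_sub1V _); rewrite ?divr_gt0// invf_div.
  have := le_trans (ler_norm _) (t_bound i); have := e0 i; have := eta_le.
  nra.
have : eta^-1 * (1 / 6 * dot z z) <= eta^-1 * \sum_i (t i - ln (1 + t i)).
  rewrite ler_wpM2l ?invr_ge0 ?(ltW eta0)// mulr_sumr; apply: ler_sum => i _.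
  have zE : z 0 i = x 0 i * t i by rewrite /z /t !mxE; field; rewrite gt_eqF.
  have tN1 : - 1 < t i.
    rewrite /t ltr_pdivlMr// mulN1r ltrBrDl subrr; exact: x'0.
  have tl : t i <= 1 / 4.
    by have := le_trans (ler_norm _) (t_bound i); have := eta_le; lra.
  have := ln1D_le tN1 tl.
  have : x 0 i ^+ 2 <= 1 by rewrite expr_le1// ltW.
  rewrite zE; have := sqr_ge0 (t i); nra.
have -> : gramform gram_shift (rho :: h) z z =
  gram_shift * dot z z + dot z rho ^+ 2 + sqdots h z.
  by rewrite /gramform /sqdots big_cons -expr2 addrA; congr (_ + _).
have -> : (2 * beta)^-1 = 7 / 22 * B.
  have : 2 * beta != 0 by rewrite mulf_neq0 ?gt_eqF.
  by move=> b2; apply: (mulfI b2); rewrite divff//; have := betaB; lra.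
have -> : eta^-1 * (1 / 6 * dot z z) = beta / 2 * (gram_shift * dot z z).
  rewrite /gram_shift; field.
  by rewrite !gt_eqF.
lra.
Qed.

(** One round increases a coordinate of the surrogate leader by a factor of at most [10 / 9], so
    [beta * dot u' rho'] is at most [5 / 9], which leaves room for [beta]. *)
Lemma round_reset u u' : leader beta eta h 0 u ->
  (forall i, u 0 i * p 0 i <= 7 / 22 * B) ->
  leader beta eta (rho :: h) 0 u' ->
  forall rho', rho' \in rho :: h -> beta * (1 + dot u' rho') <= 1.
Proof.
move=> lu up lu' rho' /round_returns[r0 r1 _].
have [su u0 _] := lu; have [su' u'0 _] := lu'.
pose v i := (u' 0 i - u 0 i) / u 0 i.
have dotu : dot u rho <= 7 / 22 * B.
  have [rr0 rr1 _] := @round_returns rho (mem_head _ _).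
  by apply: dot_le_of_prices rr0 _ rr1 up => //; have := B_ge; lra.
have dotu0 : 0 <= dot u rho by apply: sumr_ge0 => i _; rewrite mulr_ge0// ltW.
have vN1 i : - 1 < v i.
  rewrite /v ltr_pdivlMr// mulN1r ltrBrDl subrr; exact: u'0.
pose w := 1 + beta * (1 - dot u rho).
have w0 : 0 <= w <= 104 / 100.
  have : beta * dot u rho <= beta * (7 / 22 * B) by rewrite ler_wpM2l// ltW.
  have : 0 <= beta * dot u rho by rewrite mulr_ge0// ltW.
  rewrite /w; have := beta_le; have := beta0; have := betaB => *.
  by apply/andP; split; lra.
(* The coefficients have norm at most [eta * w * dot u rho], and [104 / 100 * (1 / 4) * (7 / 22)] is
   below [1 / 10]. *)
have v2 : \sum_i v i ^+ 2 <= (1 / 10 / (1 - 1 / 10)) ^+ 2.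
  apply: (@self_bounding_sum _ _ v (fun i => eta * (w * (u 0 i * rho 0 i)))
    (1 / 10) _ vN1).
  - by lra.
  - apply: le_trans (leader_stability (ltW beta0) eta0 lu lu' (t := v) _) _
      => //.
    rewrite le_eqVlt; apply/orP; left; apply/eqP; apply: eq_bigr => i _.
    by rewrite subrr mulr0 addr0.
  - apply: (@le_trans _ _ ((eta * w) ^+ 2 * (dot u rho * dot u rho))).
      rewrite [X in _ * (X * _)]/dot mulr_suml mulr_sumr; apply: ler_sum => i _.
      have ur0 : 0 <= u 0 i * rho 0 i by rewrite mulr_ge0// ltW.
      have urd : u 0 i * rho 0 i <= dot u rho.
        rewrite /dot (bigD1 i)//= lerDl; apply: sumr_ge0 => j _.
        by rewrite mulr_ge0// ltW.
      rewrite mulrA exprMn ler_wpM2l ?sqr_ge0// expr2.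
      by rewrite ler_wpM2l.
    rewrite -expr2 -exprMn ler_sqr ?nnegrE ?mulr_ge0 ?(ltW eta0)//; last first.
    - by case/andP: w0.
    have /andP[w1 w2] := w0.
    have : eta * w * dot u rho <= eta * (104 / 100) * (7 / 22 * B).
      by rewrite ler_pM ?mulr_ge0 ?(ltW eta0)// ler_wpM2l ?(ltW eta0).
    by have := etaB; lra.
have vb i : v i <= 1 / 9.
  have vi : v i ^+ 2 <= (1 / 9) ^+ 2.
    apply: le_trans (_ : _ <= (1 / 10 / (1 - 1 / 10)) ^+ 2) _.
      apply: le_trans v2; rewrite (bigD1 i)//= lerDl.
      by apply: sumr_ge0 => j _; exact: sqr_ge0.
    by rewrite le_eqVlt; apply/orP; left; apply/eqP; field.
  rewrite leNgt; apply/negP => vi9; move: vi; rewrite leNgt => /negP; apply.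
  by rewrite ltr_sqr ?nnegrE//; lra.
have u'p i : u' 0 i * p 0 i <= 10 / 9 * (7 / 22 * B).
  have -> : u' 0 i * p 0 i = (1 + v i) * (u 0 i * p 0 i).
    by rewrite /v; field; rewrite gt_eqF.
  have : 0 <= u 0 i * p 0 i by rewrite mulr_ge0// ltW.
  have := up i; have := vb i; have := vN1 i; have := B_ge; nra.
have : dot u' rho' <= 10 / 9 * (7 / 22 * B).
  by apply: dot_le_of_prices r0 _ r1 u'p => //; have := B_ge; lra.
move=> /(ler_wpM2l (ltW beta0)); have := betaB; have := beta_le; lra.
Qed.

End Round.

End Epoch.

(** * Regret of an epoch and the effect of a reset *)

Section EpochRegret.
Context {R : realType} {d : nat} (T : nat) (B eta beta : R).
Context (d_gt0 : (0 < d)%N) (dT : (110 * d <= T)%N) (B_ge : 52 <= B)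
  (etaB : eta * B = 1 / 4) (betaB : beta * B = 11 / 7).
Implicit Types (x y z u b rho r p : 'rV[R]_d) (h : seq 'rV[R]_d).

Let B0 : 0 < B. Proof. by have := B_ge; lra. Qed.
Let eta0 : 0 < eta.
Proof. by rewrite -(pmulr_lgt0 _ B0) etaB; lra. Qed.
Let beta0 : 0 < beta.
Proof. by rewrite -(pmulr_lgt0 _ B0) betaB; lra. Qed.
Let dR : (0 : R) < d%:R. Proof. by rewrite ltr0n. Qed.

(** Two comparisons meet at [u']: the comparator bound for [u] against [u'], and minimality of the
    play against [u'] in the biased objective. The bias leaves the negative term in [u'] and the
    prices. *)
Lemma epoch_regret_raw (s : bisons_state) h u u' :
  epoch_inv T B eta beta s h -> leader beta eta h 0 u' ->
  (forall rho, rho \in h -> beta * (1 + dot u' rho) <= 1) ->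
  simplex u -> (forall i, 0 < u 0 i) ->
  \sum_(rho <- h) ln (dot u rho) <=
  eta^-1 * (logbar u - d%:R * ln d%:R)
  + 7 / 22 * B * (ln (\det (gram (gram_shift eta beta) h))
                  - ln (\det (gram (gram_shift eta beta) [::] : 'M[R]_d)))
  + 5 / 4 * B * \sum_i ln (p_prev s 0 i / d%:R)
  + B * d%:R - B * \sum_i u' 0 i * p_prev s 0 i.
Proof.
move=> inv lu' hu' su u0.
have hu rho : rho \in h -> 0 < dot u rho.
  by move=> /(inv_returns inv)[_ _]; apply.
have := leader_comparator beta0 eta0 lu' hu' su u0 hu.
have [su' u'0 _] := lu'.
pose t i := (u' 0 i - play s 0 i) / play s 0 i.
have := leader_strong_min (t := t) (inv_play inv) su' u'0 (fun=> erefl).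
have [_ x0 _] := inv_play inv.
have : 0 <= eta^-1 * \sum_i (t i - ln (1 + t i)).
  rewrite mulr_ge0 ?invr_ge0 ?(ltW eta0)//; apply: sumr_ge0 => i _.
  rewrite subr_ge0; apply: le_ln1Dx.
  by rewrite /t ltr_pdivlMr// mulN1r ltrBrDl subrr.
have : 0 <= beta / 2 * sqdots h (u' - play s).
  by rewrite mulr_ge0 ?sqdots_ge0// divr_ge0// ltW.
have -> : quad beta h (B *: (p_prev s - const_mx d%:R)) u' =
    quad beta h 0 u' - (B * \sum_i u' 0 i * p_prev s 0 i - B * d%:R).
  have dE : dot u' (const_mx d%:R) = d%:R.
    rewrite /dot; under eq_bigr do rewrite mxE.
    by rewrite -mulr_suml su'.2 mul1r.
  by rewrite /quad dot0r dotZr dotBr mulrBr subr0 dE.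
have := inv_value inv.
lra.
Qed.

Context (logT_ge1 : 1 <= ln T%:R :> R) (BE : B = 264 / 5 * d%:R * ln T%:R).

Let L : R := ln T%:R.

Let dTR : 110 * d%:R <= T%:R :> R.
Proof. by rewrite -natrM ler_nat. Qed.
Let T110 : 110 <= T%:R :> R.
Proof.
have : 1 <= d%:R :> R by rewrite ler1n.
by have := dTR; lra.
Qed.
Let T0 : (0 : R) < T%:R. Proof. by have := T110; lra. Qed.

Lemma log_le_half : L <= T%:R / 2.
Proof.
have -> : L = ln (T%:R / 2) + ln 2.
  by rewrite ln_div ?posrE// subrK.
have : ln (T%:R / 2) <= T%:R / 2 - 1 :> R.
  by apply: ln_le_sub1; rewrite divr_gt0.
by have := @ln_le_sub1 R 2; lra.
Qed.

(** In units of [B * d%:R * L] the barrier costs 4, the log-determinant [14 / 11], the prices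
    [5 / 2] and the constant part of the bias 1, below 9 in total. *)
Lemma epoch_regret (s : bisons_state) h u u' :
  epoch_inv T B eta beta s h -> leader beta eta h 0 u' ->
  (forall rho, rho \in h -> beta * (1 + dot u' rho) <= 1) ->
  simplex u -> (forall i, 0 < u 0 i) -> (size h <= T)%N ->
  logbar u <= d%:R * ln d%:R + d%:R * L ->
  \sum_(rho <- h) ln (dot u rho) <=
  9 * B * d%:R * L - B * \sum_i u' 0 i * p_prev s 0 i.
Proof.
move=> inv lu' hu' su u0 hT uL.
have := epoch_regret_raw inv lu' hu' su u0.
have q0 i : 0 < p_prev s 0 i.
  by have /andP[+ _] := inv_price inv i; apply: lt_le_trans.
have shift0 : 0 < gram_shift eta beta by rewrite invr_gt0 !mulr_gt0.
have : eta^-1 * (logbar u - d%:R * ln d%:R) <= 4 * B * (d%:R * L).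
  have -> : eta^-1 = 4 * B.
    by apply: (mulfI (lt0r_neq0 eta0)); rewrite divff ?gt_eqF//;
      have := etaB; lra.
  by rewrite ler_wpM2l ?mulr_ge0 ?(ltW B0)//; lra.
have : 7 / 22 * B * (ln (\det (gram (gram_shift eta beta) h))
     - ln (\det (gram (gram_shift eta beta) [::] : 'M[R]_d)))
    <= 7 / 22 * B * (d%:R * (4 * L)).
  rewrite ler_wpM2l ?mulr_ge0 ?(ltW B0)//.
  apply: le_trans (log_det_gram_le (P := price_cap T B) shift0 d_gt0 _) _.
    move=> rho rh i; have [r0 r1 _] := inv_returns inv rh.
    rewrite r0 /=; apply: le_trans (_ : p_prev s 0 i <= _); last first.
      by have /andP[] := inv_price inv i.
    rewrite -[leRHS]mul1r -ler_pdivrMr//; apply: le_trans r1.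
    rewrite (bigD1 i)//= lerDl; apply: sumr_ge0 => j _.
    by rewrite divr_ge0// ltW.
  rewrite ler_wpM2l//.
  (* The argument of the logarithm is at most [T ^+ 4]: [d <= T], and the remaining factor is at
     most [T ^+ 3], since [B] cancels against [eta] and [beta]. *)
  have -> : 4 * L = ln (T%:R ^+ 4) by rewrite lnXn// mulr_natl.
  have szT : (size h)%:R <= T%:R :> R by rewrite ler_nat.
  have sz0 : 0 <= (size h)%:R :> R by [].
  have -> : (size h)%:R * price_cap T B ^+ 2 / gram_shift eta beta =
      (size h)%:R * (21 / 176 / 100 * T%:R ^+ 2).
    rewrite /price_cap /gram_shift invrK.
    have -> : (size h)%:R * (7 / 22 * B * (T%:R / 10)) ^+ 2 * (3 * eta * beta) =
      (size h)%:R * T%:R ^+ 2 * (147 / 484 / 100)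
        * (eta * B) * (beta * B) by field.
    by rewrite etaB betaB; field.
  have c0 : 0 <= (size h)%:R * (21 / 176 / 100 * T%:R ^+ 2) :> R.
    by rewrite mulr_ge0// mulr_ge0// sqr_ge0.
  rewrite ler_ln ?posrE ?exprn_gt0// ?mulr_gt0// ?ltr_wpDr//.
  apply: (@le_trans _ _ (T%:R * (1 + T%:R * (21 / 176 / 100 * T%:R ^+ 2)))).
    apply: ler_pM; [by []|by rewrite addr_ge0| |].
      by have := dTR; have := dR; lra.
    by rewrite lerD2l ler_wpM2r// mulr_ge0// sqr_ge0.
  have T3 : 1 + T%:R * (21 / 176 / 100 * T%:R ^+ 2) <= T%:R ^+ 3 :> R.
    have : T%:R <= T%:R ^+ 3 :> R by rewrite ler_eXnr//; have := T110; lra.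
    have := T110.
    have -> : T%:R * (21 / 176 / 100 * T%:R ^+ 2) =
        21 / 176 / 100 * T%:R ^+ 3 :> R by field.
    by set X := T%:R ^+ 3; lra.
  by rewrite [leRHS]exprS ler_wpM2l.
have : 5 / 4 * B * \sum_i ln (p_prev s 0 i / d%:R) <=
    5 / 4 * B * (d%:R * (2 * L)).
  rewrite ler_wpM2l ?mulr_ge0 ?(ltW B0)//.
  have -> : d%:R * (2 * L) = \sum_(i < d) (2 * L).
    by rewrite sumr_const card_ord mulr_natl.
  apply: ler_sum => i _.
  have -> : 2 * L = ln (T%:R ^+ 2) by rewrite lnXn// mulr_natl.
  rewrite ler_ln ?posrE ?divr_gt0 ?exprn_gt0// ler_pdivrMr//.
  have /andP[_ /le_trans] := inv_price inv i; apply.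
  rewrite /price_cap BE.
  (* [price_cap] equals [1.68 * d * L * T], hence is at most [d * T ^+ 2]. *)
  have := ler_wpM2l (ltW (mulr_gt0 dR T0)) log_le_half.
  by have := mulr_gt0 dR (mulr_gt0 T0 T0); rewrite /L; lra.
have : B * d%:R <= B * d%:R * L.
  by rewrite ler_peMr// mulr_ge0 ?(ltW B0).
have : 0 <= B * d%:R * L.
  by rewrite !mulr_ge0 ?(ltW B0)// /L; have := logT_ge1; lra.
lra.
Qed.

(** Without a reset [h'] extends [h] by the new vector and the inequality is an equality. At a reset
    [h'] is empty, so the finished epoch must have nonpositive regret. *)
Lemma bisons_stepP (s : @bisons_state R d) h r :
  epoch_inv T B eta beta s h -> no_reset B eta beta s h -> simplex r ->
  (size h < T)%N ->
  exists2 h', [/\ epoch_inv T B eta beta (bisons_step B eta beta s r) h',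
      no_reset B eta beta (bisons_step B eta beta s r) h' &
      (size h' <= (size h).+1)%N] &
    forall u, simplex u -> (forall i, 0 < u 0 i) ->
      logbar u <= d%:R * ln d%:R + d%:R * L ->
      \sum_(rho <- h) ln (dot u rho) + ln (dot u ((dot (play s) r)^-1 *: r))
      <= \sum_(rho <- h') ln (dot u rho).
Proof.
move=> inv nr sr szh.
pose x := play s; pose q := p_prev s; pose p := update_p q x.
pose rho := (dot x r)^-1 *: r.
have [_ x0 _] := inv_play inv.
have xr0 : 0 < dot x r by exact: dot_gt0.
pose fhat := surrogate beta r x.
pose g := fun y => fhat y - B * dot y (p - q).
pose x' := regularized_leader eta (g :: gs s).
pose u' := regularized_leader eta (fhat :: fhats s).
pose p' := update_p p x'.
have fE : exists c, forall y, \sum_(f <- fhat :: fhats s) f y =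
    c + quad beta (rho :: h) 0 y.
  have [c cE] := inv_fhats inv; exists (c - ln (dot x r)) => y.
  rewrite big_cons cE /fhat surrogateE// -/rho /quad big_cons; ring.
have gE : exists c, forall y, \sum_(f <- g :: gs s) f y =
    c + quad beta (rho :: h) (B *: (p - const_mx d%:R)) y.
  have [c cE] := inv_gs inv; exists (c - ln (dot x r)) => y.
  rewrite big_cons cE /g /fhat surrogateE// -/rho /quad big_cons.
  rewrite !dotZr !dotBr -/q; ring.
have lx' : leader beta eta (rho :: h) (B *: (p - const_mx d%:R)) x'.
  by have [c cE] := gE; exact: (regularized_leaderP d_gt0 (ltW beta0) eta0 cE).
have lu' : leader beta eta (rho :: h) 0 u'.
  by have [c cE] := fE; exact: (regularized_leaderP d_gt0 (ltW beta0) eta0 cE).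
pose s' := BisonsState (fhat :: fhats s) (g :: gs s) p x'.
have inv' : epoch_inv T B eta beta s' (rho :: h).
  split => //=.
  - exact: (round_move d_gt0 B_ge etaB betaB inv sr lx').
  - by move=> i; apply: (round_price d_gt0 dT B_ge etaB betaB inv nr sr szh).
  - by move=> rho'; exact: (round_returns d_gt0 inv sr).
  - exact: (round_value d_gt0 B_ge etaB betaB inv sr lx').
have stepE : bisons_step B eta beta s r =
  if [exists i, 2 * (1 + 6 * eta) * beta * u' 0 i >= (p' 0 i)^-1]
  then bisons_init else s' by [].
have [_ u'0 _] := lu'.
have p'0 i : 0 < p' 0 i.
  by apply: lt_le_trans (update_p_geV _ _ _); rewrite invr_gt0; case: lx'.
rewrite stepE; case: ifPn => [/existsP[i]|/existsPn noreset]; last first.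
  exists (rho :: h); last by move=> u *; rewrite big_cons addrC.
  split=> //; exists u' => // i /=; rewrite -/p'.
  have := noreset i; rewrite -ltNge -[(p' 0 i)^-1]mul1r ltr_pdivlMr// => hi.
  have up0 : 0 <= beta * (u' 0 i * p' 0 i) by rewrite !mulr_ge0// ltW.
  rewrite -(ler_pM2l beta0).
  have := mulr_ge0 (ltW eta0) up0; have := betaB; lra.
rewrite -[(p' 0 i)^-1]mul1r ler_pdivrMr// => reset.
have [inv0 nr0] := epoch_inv_init d_gt0 dT B_ge etaB betaB.
exists [::] => // u su u0 uL; rewrite big_nil.
have [v lv vp] := nr.
have tang := round_reset d_gt0 B_ge etaB betaB inv sr lv vp lu'.
have := epoch_regret inv' lu' tang su u0 szh uL.
rewrite big_cons addrC => /le_trans; apply.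
have : u' 0 i * p 0 i <= \sum_j u' 0 j * p 0 j.
  rewrite (bigD1 i)//= lerDl; apply: sumr_ge0 => j _; rewrite mulr_ge0 ?ltW//.
  exact: lt_le_trans (lt_le_trans dR _) (proj1 (andP (inv_price inv' j))).
have gr := round_price_growth d_gt0 B_ge etaB betaB inv sr lx' i.
(* The reset test gives [u' 0 i * p' 0 i >= 1 / (3 * beta)], which is [7 / 33 * B = 11.2 * d * L];
   passing from [p'] to [p] costs one percent. *)
have ge16 : 9 * d%:R * L <= u' 0 i * p 0 i.
  have up0 : 0 <= beta * (u' 0 i * p' 0 i) by rewrite !mulr_ge0// ltW.
  have upp : 1 <= (2 + 12 * eta) * (beta * (u' 0 i * p' 0 i)).
    by move: reset; lra.
  have eta_le : eta <= 1 / 200.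
    by rewrite -(ler_pM2r B0) etaB; have := B_ge; lra.
  have up1 : 1 / 3 <= beta * (u' 0 i * p' 0 i) by nra.
  have up2 : B * (1 / 3) <= 11 / 7 * (u' 0 i * p' 0 i).
    have -> : 11 / 7 * (u' 0 i * p' 0 i) = B * (beta * (u' 0 i * p' 0 i)).
      by rewrite -betaB; ring.
    by rewrite ler_wpM2l// ltW.
  have : u' 0 i * (99 / 100 * p' 0 i) <= u' 0 i * p 0 i.
    by rewrite ler_wpM2l// ltW.
  move: up2; rewrite BE; have := mulr_gt0 dR (lt_le_trans ltr01 logT_ge1).
  by rewrite /L; lra.
move=> sm; have := ler_wpM2l (ltW B0) (le_trans ge16 sm).
lra.
Qed.

End EpochRegret.

Lemma ln_ge1 (R : realType) (x : R) : 4 <= x -> 1 <= ln x.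
Proof.
move=> x4; apply: (@le_trans _ _ (ln (2 * 2))).
  by rewrite lnM ?posrE//; have := @ln_ge_sub1V R 2; lra.
by rewrite ler_ln ?posrE//; lra.
Qed.

(** * Moving the comparator into the interior *)

Section Mixture.
Context {R : realType} {d : nat}.
Implicit Types (u r x : 'rV[R]_d).

(** Mixing in weight [1 / T] of the uniform point makes the barrier at the comparator [O(d ln T)]
    and costs at most [2 / T] per round. *)
Definition smooth (T : nat) u : 'rV[R]_d :=
  (1 - T%:R^-1) *: u + T%:R^-1 *: const_mx d%:R^-1.

Lemma simplex_smooth T u : (0 < d)%N -> (0 < T)%N -> simplex u ->
  simplex (smooth T u).
Proof.
move=> d0 T0 [u0 u1]; have c1 : \sum_(i < d) d%:R^-1 = 1 :> R.
  have [_ c1] := @simplex_center R d d0; rewrite -[RHS]c1.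
  by apply: eq_bigr => i _; rewrite mxE.
have T1 : T%:R^-1 <= 1 :> R by rewrite invf_le1 ?ltr0n// ler1n.
split=> [i|].
  by rewrite !mxE; apply: addr_ge0; apply: mulr_ge0;
    rewrite ?subr_ge0 ?invr_ge0.
under eq_bigr do rewrite !mxE.
by rewrite big_split /= -!mulr_sumr u1 c1 !mulr1 subrK.
Qed.

Lemma smooth_ge T u i : (0 < T)%N -> simplex u ->
  (d%:R * T%:R)^-1 <= smooth T u 0 i.
Proof.
move=> T0 [u0 _]; rewrite !mxE invfM mulrC lerDr mulr_ge0// subr_ge0.
by rewrite invf_le1 ?ltr0n// ler1n.
Qed.

Lemma smooth_gt0 T u : (0 < d)%N -> (0 < T)%N -> simplex u ->
  forall i, 0 < smooth T u 0 i.
Proof.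
move=> d0 T0 su i; apply: lt_le_trans (smooth_ge _ _ _) => //.
by rewrite invr_gt0 mulr_gt0 ?ltr0n.
Qed.

Lemma logbar_smooth T u : (0 < d)%N -> (0 < T)%N -> simplex u ->
  logbar (smooth T u) <= d%:R * ln d%:R + d%:R * ln T%:R.
Proof.
move=> d0 T0 su; rewrite -mulrDr -lnM ?posrE ?ltr0n//.
rewrite /logbar -sumrN.
apply: (@le_trans _ _ (\sum_(i < d) ln (d%:R * T%:R))).
  apply: ler_sum => i _; rewrite lerNl -lnV ?posrE ?mulr_gt0 ?ltr0n//.
  rewrite ler_ln ?posrE ?invr_gt0 ?mulr_gt0 ?ltr0n//; first exact: smooth_ge.
  exact: smooth_gt0.
by rewrite sumr_const card_ord -[leLHS]mulr_natl.
Qed.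

Lemma loss_smooth T u r x : (0 < d)%N -> (1 < T)%N -> simplex u -> simplex r ->
  (forall i, 0 < x 0 i) ->
  (loss r x - loss r u <=
   (ln (dot (smooth T u) ((dot x r)^-1 *: r)) + 2 / T%:R)%:E)%E.
Proof.
move=> d0 T1 su sr x0; have T0 : (0 < T)%N by exact: ltnW.
have xr := dot_gt0 x0 sr.
have vr := dot_gt0 (smooth_gt0 d0 T0 su) sr.
rewrite /loss oppeK lne_EFin//.
(* For [dot u r = 0] the comparator has infinite loss and the difference is [-oo]. *)
have [ur|ur] := ltP 0 (dot u r); last first.
  by rewrite le0_lneNy ?lee_fin// addeNy leNye.
rewrite lne_EFin// -EFinN -EFinD lee_fin dotZr mulrC ln_div ?posrE//.
have TR : (2 : R) <= T%:R by rewrite ler_nat.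
have TV : T%:R^-1 <= 1 / 2 :> R.
  by rewrite mul1r lef_pV2 ?posrE//; lra.
have TV0 : 0 < T%:R^-1 :> R by rewrite invr_gt0; lra.
have lnv : ln ((1 - T%:R^-1) * dot u r) <= ln (dot (smooth T u) r).
  rewrite ler_ln ?posrE//; last by rewrite mulr_gt0//; lra.
  rewrite /smooth dotDl !dotZl lerDl mulr_ge0// ?(ltW TV0)//.
  apply: sumr_ge0 => i _; rewrite mxE mulr_ge0 ?invr_ge0//; exact: sr.1.
have lnT : - (2 / T%:R) <= ln (1 - T%:R^-1) :> R.
  apply: le_trans (ln_ge_sub1V _); last by lra.
  set c : R := T%:R^-1 in TV TV0 *.
  have c1 : 0 < 1 - c by lra.
  rewrite lerBrDr -(ler_pM2r c1) mulrDl mulVf ?gt_eqF//.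
  nra.
move: lnv; rewrite lnM ?posrE//; last by lra.
lra.
Qed.

End Mixture.

(** * Assembling the epochs into the regret bound *)

Theorem corollary2 (R : realType) :
  exists C : R, 0 < C /\
    forall d T : nat, (1 <= d)%N -> (110 * d ^ 2 <= T)%N ->
    forall r : nat -> 'rV[R]_d, (forall t, (t < T)%N -> simplex (r t)) ->
    let B : R := 264 / 5 * d%:R * ln T%:R in
    let eta : R := 1 / (4 * B) in
    let beta : R := 11 / (7 * B) in
    (regret T r (bisons B eta beta r) <= (C * d%:R ^+ 2 * ln T%:R ^+ 2)%:E)%E.
Proof.
(* [9 * B * d * ln T] is [475.2 * (d * ln T) ^+ 2], and smoothing adds 2 in total. *)
exists 500; split=> // d T d1 dT2 r sr; cbv zeta.
set B := 264 / 5 * _ * _; set eta := 1 / _; set beta := 11 / _.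
have dT : (110 * d <= T)%N.
  by apply: leq_trans dT2; rewrite leq_mul2l /= -mulnn leq_pmulr.
have T110 : (110 <= T)%N by apply: leq_trans dT; rewrite leq_pmulr.
have L1 : 1 <= ln T%:R :> R.
  by apply: ln_ge1; rewrite ler_nat; exact: leq_trans T110.
have dR : 1 <= d%:R :> R by rewrite ler1n.
have dL : 1 <= d%:R * ln T%:R :> R by rewrite mulr_ege1.
have B_ge : 52 <= B by rewrite /B; lra.
have B0 : B != 0 by rewrite gt_eqF//; lra.
have etaB : eta * B = 1 / 4 by rewrite /eta; field.
have betaB : beta * B = 11 / 7 by rewrite /beta; field.
(* The regret of all past rounds is bounded by that of the current epoch alone. *)
have run t : (t <= T)%N -> exists2 h,
    [/\ epoch_inv T B eta beta (bisons_run B eta beta r t) h,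
        no_reset B eta beta (bisons_run B eta beta r t) h & (size h <= t)%N] &
    forall u, simplex u -> (forall i, 0 < u 0 i) ->
      logbar u <= d%:R * ln d%:R + d%:R * ln T%:R ->
      \sum_(k < t) ln (dot u ((dot (bisons B eta beta r k) (r k))^-1 *: r k))
      <= \sum_(rho <- h) ln (dot u rho).
  elim: t => [_|t IHt tT].
    have [inv0 nr0] := epoch_inv_init d1 dT B_ge etaB betaB.
    by exists [::] => // u _ _ _; rewrite big_ord0 big_nil.
  have [h [inv nr szh] hreg] := IHt (ltnW tT).
  have [h' [inv' nr' szh'] hreg'] := bisons_stepP d1 dT B_ge etaB betaB L1
    (erefl B) inv nr (sr t tT) (leq_ltn_trans szh tT).
  exists h'; first by split=> //; exact: leq_trans szh' _.
  move=> u su u0 uL; rewrite big_ord_recr /=.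
  apply: le_trans (hreg' u su u0 uL).
  by rewrite lerD2r; exact: hreg.
apply: ge_ereal_sup => _ [u su <-].
have T0 : (0 < T)%N by exact: leq_trans T110.
have T1 : (1 < T)%N by exact: leq_trans T110.
apply: (@le_trans _ _ (\sum_(t < T) (ln (dot (smooth T u)
    ((dot (bisons B eta beta r t) (r t))^-1 *: r t)) + 2 / T%:R)%:E)%E).
  apply: lee_sum => t _; apply: loss_smooth => //; first exact: sr.
  have [h [inv _ _] _] := run t (ltnW (ltn_ord t)).
  by have [] := inv_play inv.
rewrite sumEFin lee_fin big_split /= sumr_const card_ord.
have [h [inv [u' lu' u'p] szh] hreg] := run T (leqnn T).
have su' := simplex_smooth d1 T0 su; have u0' := smooth_gt0 d1 T0 su.
have uL := logbar_smooth d1 T0 su.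
have q0 i : 0 < p_prev (bisons_run B eta beta r T) 0 i.
  by have /andP[+ _] := inv_price inv i; apply: lt_le_trans; lra.
have [_ u'0 _] := lu'.
(* After the last round the leader supplied by [no_reset] still meets the threshold, so
   [beta * dot u' rho <= 1 / 2]. *)
have tang rho : rho \in h -> beta * (1 + dot u' rho) <= 1.
  move=> /(inv_returns inv)[r0 r1 _].
  have : dot u' rho <= 7 / 22 * B.
    apply: dot_le_of_prices r0 q0 r1 _ => [|i]; first by lra.
    apply: le_trans (u'p i); rewrite ler_wpM2l ?(ltW (u'0 i))//.
    exact: update_p_ge.
  have beta0 : 0 < beta by rewrite divr_gt0//; lra.
  move=> /(ler_wpM2l (ltW beta0)).
  have : beta <= 1 / 4 by rewrite -(@ler_pM2r _ B) ?betaB; lra.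
  by move: betaB; lra.
have := epoch_regret d1 dT B_ge etaB betaB L1 (erefl B) inv lu' tang su' u0'
  szh uL.
have : 0 <= B * \sum_i u' 0 i * p_prev (bisons_run B eta beta r T) 0 i.
  rewrite mulr_ge0 ?sumr_ge0//; first by lra.
  by move=> i _; rewrite mulr_ge0 ?ltW.
have := hreg _ su' u0' uL.
have -> : 2 / T%:R *+ T = 2 :> R.
  by rewrite -mulr_natr divfK// pnatr_eq0 -lt0n.
have : 1 <= (d%:R * ln T%:R) ^+ 2 :> R by rewrite expr_ge1// (le_trans ler01).
rewrite /B exprMn; lra.
Qed.
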